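(* Let $\mathcal{M}=\langle M,\in^{\mathcal M}\rangle$ be an $\mathcal{L}$-structure with $\mathcal{M}\models\mathrm{MOST}$, and let $j:\mathcal{M}\to\mathcal{M}$ be a non-trivial automorphism such that $\omega^{\mathcal M}\in I_{\mathrm{fix}}(j)$. Then $I_{\mathrm{fix}}(j)\subseteq M$ is an $H$-cut of $\mathcal{M}$.
   Context: $\mathcal{L}$ is the first-order language with one binary relation symbol $\in$. For an $\mathcal{L}$-structure $\mathcal{M}$ with domain $M$ and $a\in M$, write $a^*=\{x\in M:\mathcal{M}\models x\in a\}$. $\mathrm{Mac}$ is the theory with axioms: extensionality, pairing, emptyset, union, infinity, powerset, transitive containment ($\forall x\exists y(\bigcup y\subseteq y\wedge x\subseteq y)$), $\Delta_0$-separation, set foundation (every nonempty set $x$ has an element $y$ with no element in common with $x$), and choice in the form ''every set can be well-ordered''. $\mathrm{MOST}$ is $\mathrm{Mac}$ plus $\Sigma_1$-separation plus $\Delta_0$-collection ($\Delta_0,\Sigma_1$ are the Lévy classes). For $\mathcal{L}$-structures $\mathcal{A}\subseteq\mathcal{B}$: $\mathcal{B}$ is an end-extension of $\mathcal{A}$ if whenever $x\in A$, $y\in B$ and $\mathcal{B}\models y\in x$ then $y\in A$; it is powerset-preserving if moreover for all $x\in B$, $y\in A$ with $\mathcal{B}\models x\subseteq y$ we have $x\in A$; it is topless if it is an end-extension, $A\neq B$, and whenever $C\in B$ with $C^*\subseteq \mathrm{Ord}^{\mathcal A}$ then $C\in A$. Write $\mathcal{A}\subseteq^{\mathcal P}_{\mathrm{topless}}\mathcal{B}$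 if $\mathcal{B}$ is a topless, powerset-preserving end-extension of $\mathcal{A}$. For $\mathcal{M}\models\mathrm{MOST}$, a set $I\subseteq M$ is an $H$-cut of $\mathcal{M}$ if $\langle I,\in^{\mathcal M}\rangle\subseteq^{\mathcal P}_{\mathrm{topless}}\mathcal{M}$ and $\langle I,\in^{\mathcal M}\rangle\models\mathrm{MOST}$ (here $\langle I,\in^{\mathcal M}\rangle$ is the substructure of $\mathcal M$ with domain $I$). For an automorphism $j$ of $\mathcal{M}\models\mathrm{MOST}$, $I_{\mathrm{fix}}(j)=\{x\in M: j(y)=y \text{ for all } y\in M \text{ with } \mathcal{M}\models y\in\mathrm{TC}(\{x\})\}$, where $\mathrm{TC}$ (transitive closure, the smallest transitive set containing the argument) is computed in $\mathcal M$; $\mathcal{I}_{\mathrm{fix}}(j)$ is the substructure of $\mathcal M$ with domain $I_{\mathrm{fix}}(j)$. Non-trivial means not the identity. *)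

(* Defs.v *)
From Stdlib Require Import FinFun.

Set Implicit Arguments.
Unset Strict Implicit.

Declare Scope set_theory_scope.
Open Scope set_theory_scope.

Record structure : Type := Structure {
  dom :> Type;
  mem : dom -> dom -> Prop
}.

Notation "x ∈ y" := (mem x y) (at level 70, no associativity) : set_theory_scope.

(** First-order formulas with equality over one binary relation symbol, with
    de Bruijn indices: a quantifier binds index 0 and shifts the others. *)
Inductive form : Type :=
| fMem (i k : nat)
| fEq (i k : nat)
| fBot
| fAnd (p q : form)
| fOr (p q : form)
| fImp (p q : form)
| fAll (p : form)
| fEx (p : form).

Definition scons (T : Type) (x : T) (v : nat -> T) : nat -> T :=
  fun n => match n with 0 => x | S k => v k end.

Fixpoint sat (M : structure) (v : nat -> M) (p : form) : Prop :=
  match p with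
  | fMem i k => v i ∈ v k
  | fEq i k => v i = v k
  | fBot => False
  | fAnd p q => sat v p /\ sat v q
  | fOr p q => sat v p \/ sat v q
  | fImp p q => sat v p -> sat v q
  | fAll p => forall x : M, sat (scons x v) p
  | fEx p => exists x : M, sat (scons x v) p
  end.

(** The bound of a bounded quantifier has index [S i] below the quantifier, so
    it is never the bound variable itself. *)
Inductive Delta0 : form -> Prop :=
| Delta0_Mem i k : Delta0 (fMem i k)
| Delta0_Eq i k : Delta0 (fEq i k)
| Delta0_Bot : Delta0 fBot
| Delta0_And p q : Delta0 p -> Delta0 q -> Delta0 (fAnd p q)
| Delta0_Or p q : Delta0 p -> Delta0 q -> Delta0 (fOr p q)
| Delta0_Imp p q : Delta0 p -> Delta0 q -> Delta0 (fImp p q)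
| Delta0_All i p : Delta0 p -> Delta0 (fAll (fImp (fMem 0 (S i)) p))
| Delta0_Ex i p : Delta0 p -> Delta0 (fEx (fAnd (fMem 0 (S i)) p)).

Inductive Sigma1 : form -> Prop :=
| Sigma1_Delta0 p : Delta0 p -> Sigma1 p
| Sigma1_Ex p : Sigma1 p -> Sigma1 (fEx p).

(** Set-theoretic notions interpreted in a structure [M]. Every quantifier
    ranges over elements of [M], so each is first-order definable. *)
Section Notions.
Variable M : structure.
Implicit Types a b p r s t u x y z : M.

Definition incl x y : Prop := forall z, z ∈ x -> z ∈ y.

Definition is_empty x : Prop := forall z, ~ z ∈ x.

Definition is_upair p a b : Prop := forall z, z ∈ p <-> z = a \/ z = b.

Definition is_singleton s a : Prop := forall z, z ∈ s <-> z = a.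

(** Kuratowski pair. *)
Definition is_opair p a b : Prop :=
  exists s t, is_singleton s a /\ is_upair t a b /\ is_upair p s t.

Definition is_union u x : Prop := forall z, z ∈ u <-> exists y, y ∈ x /\ z ∈ y.

Definition is_powerset y x : Prop := forall z, z ∈ y <-> incl z x.

Definition is_succ s x : Prop := forall z, z ∈ s <-> z ∈ x \/ z = x.

Definition inductive_set x : Prop :=
  (exists e, is_empty e /\ e ∈ x) /\
  (forall y, y ∈ x -> exists s, is_succ s y /\ s ∈ x).

Definition transitive_set x : Prop := forall y z, y ∈ x -> z ∈ y -> z ∈ x.

(** [R] is a strict well-ordering of the set [x]; the subsets [s] of [x] that
    must have a least element are those that are elements of [M]. *)
Definition well_orders (R : M -> M -> Prop) x : Prop :=
  (forall a, a ∈ x -> ~ R a a) /\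
  (forall a b c, a ∈ x -> b ∈ x -> c ∈ x -> R a b -> R b c -> R a c) /\
  (forall a b, a ∈ x -> b ∈ x -> R a b \/ a = b \/ R b a) /\
  (forall s, incl s x -> (exists a, a ∈ s) ->
     exists a, a ∈ s /\ forall b, b ∈ s -> b = a \/ R a b).

Definition is_rel_on r x : Prop :=
  forall p, p ∈ r -> exists a b, a ∈ x /\ b ∈ x /\ is_opair p a b.

Definition rel_of r a b : Prop := exists p, is_opair p a b /\ p ∈ r.

Definition Ord x : Prop := transitive_set x /\ well_orders (@mem M) x.

Definition is_omega x : Prop :=
  inductive_set x /\ forall y, inductive_set y -> incl x y.

Definition is_TC t x : Prop :=
  transitive_set t /\ incl x t /\
  forall u, transitive_set u -> incl x u -> incl t u.

(** Free variables of the formula in the schemes: index 0 is the element being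
    separated, the remaining indices are parameters. *)
Definition separation (G : form -> Prop) : Prop :=
  forall p : form, G p -> forall (v : nat -> M) a,
    exists b, forall x, x ∈ b <-> x ∈ a /\ sat (scons x v) p.

(** Index 0 is the witness [y], index 1 is [x], the rest are parameters. *)
Definition collection (G : form -> Prop) : Prop :=
  forall p : form, G p -> forall (v : nat -> M) a,
    (forall x, x ∈ a -> exists y, sat (scons y (scons x v)) p) ->
    exists b, forall x, x ∈ a -> exists y, y ∈ b /\ sat (scons y (scons x v)) p.

End Notions.

Record models_Mac (M : structure) : Prop := {
  Mac_extensionality : forall x y : M, (forall z, z ∈ x <-> z ∈ y) -> x = y;
  Mac_pairing : forall a b : M, exists p, is_upair p a b;
  Mac_emptyset : exists e : M, is_empty e;
  Mac_union : forall x : M, exists u, is_union u x;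
  Mac_infinity : exists x : M, inductive_set x;
  Mac_powerset : forall x : M, exists y, is_powerset y x;
  Mac_transitive_containment :
    forall x : M, exists y, transitive_set y /\ incl x y;
  Mac_Delta0_separation : separation M Delta0;
  Mac_foundation :
    forall x : M, (exists y, y ∈ x) ->
      exists y, y ∈ x /\ ~ exists z, z ∈ y /\ z ∈ x;
  Mac_choice :
    forall x : M, exists r, is_rel_on r x /\ well_orders (rel_of r) x
}.

Record models_MOST (M : structure) : Prop := {
  MOST_Mac : models_Mac M;
  MOST_Sigma1_separation : separation M Sigma1;
  MOST_Delta0_collection : collection M Delta0
}.

Definition substructure (M : structure) (I : M -> Prop) : structure :=
  {| dom := {x : M | I x}; mem := fun x y => proj1_sig x ∈ proj1_sig y |}.

(** Extensions A ⊆ B: the substructure A of [B] is given by its domain [A]. *)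
Section Extensions.
Variables (B : structure) (A : B -> Prop).

Definition end_extension : Prop :=
  forall x y : B, A x -> y ∈ x -> A y.

Definition powerset_preserving : Prop :=
  end_extension /\ forall x y : B, A y -> incl x y -> A x.

(** Ord^A, evaluated in the substructure. *)
Definition Ord_sub (x : B) : Prop :=
  exists hx : A x, Ord (exist A x hx : substructure A).

Definition topless : Prop :=
  end_extension /\
  (exists x : B, ~ A x) /\
  (forall C : B, (forall x, x ∈ C -> Ord_sub x) -> A C).

Definition topless_powerset_preserving : Prop :=
  topless /\ powerset_preserving.

End Extensions.

Definition H_cut (M : structure) (I : M -> Prop) : Prop :=
  topless_powerset_preserving I /\ models_MOST (substructure I).

Definition automorphism (M : structure) (j : M -> M) : Prop :=
  Bijective j /\ forall x y : M, x ∈ y <-> j x ∈ j y.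

Definition in_TC_singleton (M : structure) (y x : M) : Prop :=
  exists s t : M, is_singleton s x /\ is_TC t s /\ y ∈ t.

Definition I_fix (M : structure) (j : M -> M) (x : M) : Prop :=
  forall y : M, in_TC_singleton y x -> j y = y.

(* Main.v *)
From Stdlib Require Import Classical ClassicalEpsilon FunctionalExtensionality
  ProofIrrelevance Arith Lia List.
Require Import Defs.
Import ListNotations.

Set Implicit Arguments.
Unset Strict Implicit.

(** Let [I] be the class of hereditarily fixed elements. A set of [M] all of
    whose elements lie in [I] lies in [I] itself; this gives toplessness,
    preservation of powersets, and all axioms of Mac except separation.
    Σ1-separation and Δ0-collection follow from those of [M] once [I] is known
    to be a Σ1-elementary substructure of [M]. For this, let a Δ0 formula with
    parameters in a transitive [A ∈ I], [ω ⊆ A], have a witness in [M]. Inside a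
    transitive set [T] containing [A] and the witness, take the Skolem hull [N]
    of [A] for the finitely many subformulas, with a well-ordering of [T] giving
    the Skolem functions. The elements of [N] are named by Skolem terms, and these
    are coded by elements of [D := P(P(A)) ∈ I], since successor on [ω] yields
    disjoint injections of [P(A)] into itself, hence tupling on [D]. So the
    membership relation of [N], pulled back to [D], belongs to [I] and is fixed
    by [j]; its transitive collapse, being unique, is fixed too and lies in [I].
    The collapse is the identity on [A] and preserves the formula. *)

(** * Formulas *)

Definition lift (f : nat -> nat) (n : nat) : nat :=
  match n with 0 => 0 | S k => S (f k) end.

Fixpoint ren (f : nat -> nat) (p : form) : form :=
  match p with
  | fMem i k => fMem (f i) (f k)
  | fEq i k => fEq (f i) (f k)
  | fBot => fBot
  | fAnd p q => fAnd (ren f p) (ren f q)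
  | fOr p q => fOr (ren f p) (ren f q)
  | fImp p q => fImp (ren f p) (ren f q)
  | fAll p => fAll (ren (lift f) p)
  | fEx p => fEx (ren (lift f) p)
  end.

Lemma Delta0_ren p : Delta0 p -> forall f, Delta0 (ren f p).
Proof. induction 1; intros f; simpl; constructor; auto. Qed.

Lemma sat_ren (M : structure) p : forall f (v : nat -> M),
  sat v (ren f p) <-> sat (fun i => v (f i)) p.
Proof.
assert (E : forall f (x : M) v,
  (fun i => scons x v (lift f i)) = scons x (fun i => v (f i))).
{ intros f x v; extensionality i; destruct i; reflexivity. }
induction p as [i k|i k| |p IHp q IHq|p IHp q IHq|p IHp q IHq|p IHp|p IHp];
  intros f v; simpl; try rewrite IHp; try rewrite IHq; try tauto.
- split; intros H x; specialize (H x); rewrite IHp, E in *; exact H.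
- split; intros [x H]; exists x; rewrite IHp, E in *; exact H.
Qed.

Fixpoint var_bound (p : form) : nat :=
  match p with
  | fMem i k | fEq i k => S (max i k)
  | fBot => 0
  | fAnd p q | fOr p q | fImp p q => max (var_bound p) (var_bound q)
  | fAll p | fEx p => pred (var_bound p)
  end.

(** Assignments are infinite sequences, while a Skolem term takes finitely many arguments; [local k]
    is what permits the truncation. *)
Definition local (T : Type) (k : nat) (P : (nat -> T) -> Prop) : Prop :=
  forall u v, (forall i, i < k -> u i = v i) -> P u -> P v.

Lemma sat_local (M : structure) p :
  local (var_bound p) (fun v : nat -> M => sat v p).
Proof.
assert (S0 : forall (u v : nat -> M) k x, (forall i, i < pred k -> u i = v i) ->
  forall i, i < k -> scons x u i = scons x v i).
{ intros u v k x H [|i] Hi; simpl; auto; apply H; lia. }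
unfold local.
induction p as [i k|i k| |p IHp q IHq|p IHp q IHq|p IHp q IHq|p IHp|p IHp];
  intros u v H; simpl in *.
- now rewrite (H i), (H k) by lia.
- now rewrite (H i), (H k) by lia.
- trivial.
- intros [Hp Hq]; split; [apply (IHp u)|apply (IHq u)]; auto;
    intros; apply H; lia.
- intros [Hp|Hq]; [left; apply (IHp u)|right; apply (IHq u)]; auto;
    intros; apply H; lia.
- intros Hpq Hp; apply (IHq u); [intros; apply H; lia|]; apply Hpq.
  apply (IHp v); auto; intros; symmetry; apply H; lia.
- intros Hp x; apply (IHp (scons x u)); [now apply S0|auto].
- intros [x Hp]; exists x; apply (IHp (scons x u)); [now apply S0|auto].
Qed.

(** Formulas whose witnesses a substructure must contain to reflect [p]. *)
Fixpoint skolem_forms (p : form) : list form :=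
  match p with
  | fMem _ _ | fEq _ _ | fBot => []
  | fAnd p q | fOr p q | fImp p q => skolem_forms p ++ skolem_forms q
  | fAll p => fImp p fBot :: skolem_forms p
  | fEx p => p :: skolem_forms p
  end.

Lemma Delta0_skolem_forms p :
  Delta0 p -> forall q, In q (skolem_forms p) -> Delta0 q.
Proof.
induction 1 as [| | |p q Hp IHp Hq IHq|p q Hp IHp Hq IHq|p q Hp IHp Hq IHq
  |i p Hp IHp|i p Hp IHp]; intros r Hr; simpl in Hr; try tauto;
  try (apply in_app_iff in Hr; destruct Hr; auto).
- destruct Hr as [<-|Hr]; auto; repeat constructor; auto.
- destruct Hr as [<-|Hr]; auto; repeat constructor; auto.
Qed.

(** * Definable predicates *)

Section DefinablePredicates.
Variable M : structure.
Implicit Types (v : nat -> M) (P Q : (nat -> M) -> Prop).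

Definition ev (e : nat + M) v : M := match e with inl i => v i | inr c => c end.

(** Predicates on assignments given by a Δ0 formula with parameters; the
    parameters are substituted for variables by [e]. *)
Definition D0 P : Prop :=
  exists p (e : nat -> nat + M), Delta0 p /\
    forall v, P v <-> sat (fun i => ev (e i) v) p.

Definition is_term (t : (nat -> M) -> M) : Prop := exists e, forall v, t v = ev e v.

Lemma is_term_var i : is_term (fun v => v i).
Proof. now exists (inl i). Qed.

Lemma is_term_const c : is_term (fun _ => c).
Proof. now exists (inr c). Qed.

Lemma is_term_ren t (f : nat -> nat) :
  is_term t -> is_term (fun v => t (fun n => v (f n))).
Proof.
intros [[i|c] Ht]; [exists (inl (f i))|exists (inr c)]; intros v; now rewrite Ht.
Qed.

Lemma D0_iff P Q : (forall v, P v <-> Q v) -> D0 Q -> D0 P.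
Proof.
intros H (p & e & Hp & He); exists p, e; split; auto.
intros v; now rewrite H.
Qed.

Lemma D0_sat p : Delta0 p -> D0 (fun v => sat v p).
Proof. intros Hp; exists p, inl; split; auto; reflexivity. Qed.

Lemma D0_mem s t : is_term s -> is_term t -> D0 (fun v => s v ∈ t v).
Proof.
intros [a Ha] [b Hb]; exists (fMem 0 1), (scons a (fun _ => b)); split.
- constructor.
- intros v; simpl; now rewrite Ha, Hb.
Qed.

Lemma D0_eq s t : is_term s -> is_term t -> D0 (fun v => s v = t v).
Proof.
intros [a Ha] [b Hb]; exists (fEq 0 1), (scons a (fun _ => b)); split.
- constructor.
- intros v; simpl; now rewrite Ha, Hb.
Qed.

(** By excluded middle, a proposition that ignores the assignment is equivalent to a formula for
    truth or to one for falsity. *)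
Lemma D0_prop (A : Prop) : D0 (fun _ => A).
Proof.
destruct (classic A) as [HA|HA].
- exists (fImp fBot fBot), inl; split; [repeat constructor|simpl; tauto].
- exists fBot, inl; split; [constructor|simpl; tauto].
Qed.

Definition interleave (T : Type) (a b : nat -> T) (n : nat) : T :=
  if Nat.even n then a (Nat.div2 n) else b (Nat.div2 n).

Lemma interleave_even (T : Type) (a b : nat -> T) n :
  interleave a b (2 * n) = a n.
Proof.
unfold interleave; rewrite Nat.div2_double.
replace (Nat.even (2 * n)) with true; auto.
symmetry; apply Nat.even_spec; now exists n.
Qed.

Lemma interleave_odd (T : Type) (a b : nat -> T) n :
  interleave a b (S (2 * n)) = b n.
Proof.
unfold interleave; rewrite Nat.div2_succ_double.
replace (Nat.even (S (2 * n))) with false; auto.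
rewrite Nat.even_succ, <- Nat.negb_even.
replace (Nat.even (2 * n)) with true; auto.
symmetry; apply Nat.even_spec; now exists n.
Qed.

(** The variables of the two formulas are moved to even and odd indices, so that a single
    substitution serves both. *)
Lemma D0_common P Q : D0 P -> D0 Q -> exists p q e,
  Delta0 p /\ Delta0 q /\
  (forall v, P v <-> sat (fun i => ev (e i) v) p) /\
  (forall v, Q v <-> sat (fun i => ev (e i) v) q).
Proof.
intros (p & a & Hp & Ha) (q & b & Hq & Hb).
exists (ren (fun n => 2 * n) p), (ren (fun n => S (2 * n)) q), (interleave a b).
repeat split; try now apply Delta0_ren.
- rewrite Ha, sat_ren; apply sat_local; intros; now rewrite interleave_even.
- rewrite Ha, sat_ren; apply sat_local; intros; now rewrite interleave_even.
- rewrite Hb, sat_ren; apply sat_local; intros; now rewrite interleave_odd.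
- rewrite Hb, sat_ren; apply sat_local; intros; now rewrite interleave_odd.
Qed.

Lemma D0_and P Q : D0 P -> D0 Q -> D0 (fun v => P v /\ Q v).
Proof.
intros HP HQ; destruct (D0_common HP HQ) as (p & q & e & Hp & Hq & Ep & Eq).
exists (fAnd p q), e; split; [now constructor|].
intros v; simpl; now rewrite Ep, Eq.
Qed.

Lemma D0_or P Q : D0 P -> D0 Q -> D0 (fun v => P v \/ Q v).
Proof.
intros HP HQ; destruct (D0_common HP HQ) as (p & q & e & Hp & Hq & Ep & Eq).
exists (fOr p q), e; split; [now constructor|].
intros v; simpl; now rewrite Ep, Eq.
Qed.

Lemma D0_imp P Q : D0 P -> D0 Q -> D0 (fun v => P v -> Q v).
Proof.
intros HP HQ; destruct (D0_common HP HQ) as (p & q & e & Hp & Hq & Ep & Eq).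
exists (fImp p q), e; split; [now constructor|].
intros v; simpl; now rewrite Ep, Eq.
Qed.

Lemma D0_not P : D0 P -> D0 (fun v => ~ P v).
Proof. intros HP; apply D0_imp; auto; apply D0_prop. Qed.

Lemma D0_equiv P Q : D0 P -> D0 Q -> D0 (fun v => P v <-> Q v).
Proof. intros HP HQ; apply D0_and; apply D0_imp; auto. Qed.

(** Under [e] several indices may stand for variable 0. They are all renamed to 0 and the others
    move up by one, which leaves 0 as a genuine variable that can be quantified or separated on. The
    value [inl 0] in the new substitution is a dummy: the formula no longer mentions those
    indices. *)
Lemma D0_bind P : D0 P -> exists p e, Delta0 p /\
  forall x v, P (scons x v) <-> sat (scons x (fun i => ev (e i) v)) p.
Proof.
intros (p & e & Hp & He).
exists (ren (fun n => match e n with inl 0 => 0 | _ => S n end) p),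
  (fun n => match e n with inl (S k) => inl k | inl 0 => inl 0 | inr c => inr c end).
split; [now apply Delta0_ren|].
intros x v; rewrite He, sat_ren.
assert (E : forall n, ev (e n) (scons x v) =
  scons x (fun i => ev match e i with
                       | inl (S k) => inl k | inl 0 => inl 0 | inr c => inr c end v)
    match e n with inl 0 => 0 | _ => S n end).
{ intros n; destruct (e n) as [[|k]|c] eqn:En; simpl; rewrite ?En; reflexivity. }
split; apply sat_local; intros i _; rewrite E; reflexivity.
Qed.

Lemma D0_bind2 P : D0 P -> exists p e, Delta0 p /\
  forall x y v, P (scons y (scons x v)) <->
    sat (scons y (scons x (fun i => ev (e i) v))) p.
Proof.
intros (p & e & Hp & He).
exists (ren (fun n => match e n with
                      | inl 0 => 0 | inl 1 => 1 | _ => S (S n) end) p),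
  (fun n => match e n with inl (S (S k)) => inl k | inl k => inl k | inr c => inr c end).
split; [now apply Delta0_ren|].
intros x y v; rewrite He, sat_ren.
set (w := scons y _).
assert (E : forall n, ev (e n) w = scons y (scons x (fun i => ev match e i with
    | inl (S (S k)) => inl k | inl k => inl k | inr c => inr c end v))
    match e n with inl 0 => 0 | inl 1 => 1 | _ => S (S n) end).
{ intros n; destruct (e n) as [[|[|k]]|c] eqn:En; simpl; rewrite ?En; reflexivity. }
split; apply sat_local; intros i _; rewrite E; reflexivity.
Qed.

Lemma D0_subst P (t : nat -> (nat -> M) -> M) : (forall i, is_term (t i)) ->
  D0 P -> D0 (fun v => P (fun i => t i v)).
Proof.
intros Ht (p & e & Hp & He).
pose (f i := proj1_sig (constructive_indefinite_description _ (Ht i))).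
assert (Hf : forall i v, t i v = ev (f i) v)
  by (intros i; exact (proj2_sig (constructive_indefinite_description _ (Ht i)))).
exists p, (fun n => match e n with inl i => f i | inr c => inr c end).
split; auto; intros v; rewrite He.
split; apply sat_local; intros n _; destruct (e n); simpl; rewrite ?Hf; auto.
Qed.

Lemma D0_subst1 (A : M -> Prop) s :
  is_term s -> D0 (fun v => A (v 0)) -> D0 (fun v => A (s v)).
Proof. intros Hs; now apply (@D0_subst (fun v => A (v 0)) (fun _ => s)). Qed.

Lemma D0_subst2 (R : M -> M -> Prop) s t : is_term s -> is_term t ->
  D0 (fun v => R (v 0) (v 1)) -> D0 (fun v => R (s v) (t v)).
Proof.
intros Hs Ht.
apply (@D0_subst (fun v => R (v 0) (v 1)) (scons s (fun _ => t))).
now intros [|i].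
Qed.

Lemma D0_subst3 (R : M -> M -> M -> Prop) r s t :
  is_term r -> is_term s -> is_term t ->
  D0 (fun v => R (v 0) (v 1) (v 2)) -> D0 (fun v => R (r v) (s v) (t v)).
Proof.
intros Hr Hs Ht.
apply (@D0_subst (fun v => R (v 0) (v 1) (v 2)) (scons r (scons s (fun _ => t)))).
now intros [|[|i]].
Qed.

Lemma D0_all t (P : M -> (nat -> M) -> Prop) :
  is_term t -> D0 (fun v => P (v 0) (fun n => v (S n))) ->
  D0 (fun v => forall x, x ∈ t v -> P x v).
Proof.
intros [a Ha] HP; destruct (D0_bind HP) as (p & e & Hp & He).
(* The bound [t] becomes the first parameter, hence has index 1 below the quantifier; [lift S] moves
   the other parameters past it. *)
exists (fAll (fImp (fMem 0 1) (ren (lift S) p))), (scons a e); split.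
- constructor; now apply Delta0_ren.
- intros v; simpl; rewrite Ha.
  split; intros H x Hx; specialize (H x Hx); specialize (He x v); simpl in He;
    [rewrite sat_ren|rewrite sat_ren in H]; [apply He in H|apply He];
    revert H; apply sat_local; intros [|i] _; reflexivity.
Qed.

Lemma D0_ex t (P : M -> (nat -> M) -> Prop) :
  is_term t -> D0 (fun v => P (v 0) (fun n => v (S n))) ->
  D0 (fun v => exists x, x ∈ t v /\ P x v).
Proof.
intros Ht HP; apply D0_iff with
  (Q := fun v => ~ forall x, x ∈ t v -> ~ P x v).
- intros v; split.
  + intros (x & Hx & Hp) H; exact (H x Hx Hp).
  + intros H; apply NNPP; intros N; apply H; intros x Hx Hp; apply N; eauto.
- apply D0_not, D0_all; auto; now apply D0_not.
Qed.

Lemma D0_bounded_forall k (P : nat -> (nat -> M) -> Prop) :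
  (forall i, D0 (P i)) -> D0 (fun v => forall i, i < k -> P i v).
Proof.
intros H; induction k as [|k IH].
- apply D0_iff with (Q := fun _ => True); [|apply D0_prop].
  intros v; split; auto; intros _ i Hi; lia.
- apply D0_iff with (Q := fun v => (forall i, i < k -> P i v) /\ P k v);
    [|now apply D0_and].
  intros v; split.
  + intros Hv; split; [intros i Hi|]; apply Hv; lia.
  + intros [Hv Hk] i Hi; destruct (Nat.eq_dec i k) as [->|Ni]; auto;
      apply Hv; lia.
Qed.

Definition prepend (k : nat) (u v : nat -> M) (n : nat) : M :=
  if n <? k then u n else v (n - k).

(** Only the values of [u] below [k] matter, so the quantifier over assignments is a block of [k]
    bounded quantifiers. The induction peels off [u k] and puts it at the head of [v]. *)
Lemma D0_bounded_ex k (c : M) P : D0 P ->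
  D0 (fun v => exists u, (forall i, i < k -> u i ∈ c) /\ P (prepend k u v)).
Proof.
intros HP; induction k as [|k IH].
- revert HP; apply D0_iff; intros v.
  assert (E : forall u, prepend 0 u v = v).
  { intros u; extensionality n; unfold prepend; simpl; f_equal; lia. }
  split.
  + intros (u & _ & Hu); now rewrite E in Hu.
  + intros H; exists v; split; [intros; lia|now rewrite E].
- apply D0_iff with (Q := fun v => exists x, x ∈ c /\
    exists u, (forall i, i < k -> u i ∈ c) /\ P (prepend k u (scons x v))).
  + intros v; split.
    * intros (u & Hu & HPu); exists (u k); split; [apply Hu; lia|].
      exists u; split; [intros; apply Hu; lia|].
      replace (prepend k u (scons (u k) v)) with (prepend (S k) u v); auto.
      extensionality n; unfold prepend.
      destruct (Nat.ltb_spec n (S k)), (Nat.ltb_spec n k); try lia; auto.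
      -- replace n with k by lia; rewrite Nat.sub_diag; reflexivity.
      -- replace (n - k) with (S (n - S k)) by lia; reflexivity.
    * intros (x & Hx & u & Hu & HPu).
      exists (fun i => if i =? k then x else u i); split.
      -- intros i Hi; destruct (Nat.eqb_spec i k); auto; apply Hu; lia.
      -- replace (prepend (S k) _ v) with (prepend k u (scons x v)); auto.
         extensionality n; unfold prepend.
         destruct (Nat.ltb_spec n (S k)), (Nat.ltb_spec n k),
           (Nat.eqb_spec n k); try lia; auto.
         ++ subst n; rewrite Nat.sub_diag; reflexivity.
         ++ replace (n - k) with (S (n - S k)) by lia; reflexivity.
  + apply (D0_ex (t := fun _ => c)); [apply is_term_const|].
    revert IH; apply D0_iff; intros v.
    replace (scons (v 0) (fun n => v (S n))) with v; [reflexivity|].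
    extensionality n; now destruct n.
Qed.

End DefinablePredicates.

(** * Automation for definability *)

Ltac d0_term :=
  first [assumption | apply is_term_var | apply is_term_const
        | apply is_term_ren; assumption | apply is_term_ren; d0_term].


Ltac d0_subst :=
  match goal with
  | |- D0 (fun v => ?A (@?s v)) => apply (@D0_subst1 _ A s); [d0_term | assumption]
  | |- D0 (fun v => ?R (@?s v) (@?t v)) =>
      apply (@D0_subst2 _ R s t); [d0_term | d0_term | assumption]
  | |- D0 (fun v => ?R (@?r v) (@?s v) (@?t v)) =>
      apply (@D0_subst3 _ R r s t); [d0_term | d0_term | d0_term | assumption]
  end.

(** A hook, redefined once the basic set-theoretic relations are known to be Δ0. *)
Ltac d0_atom := fail.

Ltac d0 :=
  cbv beta;
  lazymatch goal with
  | |- D0 (fun v => forall x, x ∈ @?t v -> @?P v x) =>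
      apply (@D0_all _ t (fun x v => P v x)); [d0_term | d0]
  | |- D0 (fun v => exists x, x ∈ @?t v /\ @?P v x) =>
      apply (@D0_ex _ t (fun x v => P v x)); [d0_term | d0]
  | |- D0 (fun v => @?s v ∈ @?t v) => apply (@D0_mem _ s t); d0_term
  | |- D0 (fun v => @?s v = @?t v) =>
      first [apply (@D0_eq _ s t); d0_term | apply D0_prop]
  | |- D0 (fun v => @?P v /\ @?Q v) => apply (@D0_and _ P Q); d0
  | |- D0 (fun v => @?P v \/ @?Q v) => apply (@D0_or _ P Q); d0
  | |- D0 (fun v => @?P v <-> @?Q v) => apply (@D0_equiv _ P Q); d0
  | |- D0 (fun v => ~ @?P v) => apply (@D0_not _ P); d0
  | |- D0 (fun v => @?P v -> @?Q v) => apply (@D0_imp _ P Q); d0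
  | |- D0 (fun v => incl _ _) => unfold incl; d0
  | |- D0 (fun v => is_empty _) => unfold is_empty; d0
  | |- _ => first [d0_atom | apply D0_prop | d0_subst]
  end.

(** * Δ0 definitions of basic set-theoretic notions *)

Section DefinableNotions.
Variable M : structure.
Implicit Types s t r : (nat -> M) -> M.

Lemma D0_transitive_set t : is_term t -> D0 (fun v => transitive_set (t v)).
Proof.
intros Ht; apply D0_iff with
  (Q := fun v => forall y, y ∈ t v -> forall z, z ∈ y -> z ∈ t v).
- intros v; unfold transitive_set; firstorder.
- d0.
Qed.

(** The singleton and the unordered pair inside a Kuratowski pair are elements of it, so the pair
    itself bounds the quantifiers. *)
Lemma D0_is_opair r s t :
  is_term r -> is_term s -> is_term t -> D0 (fun v => is_opair (r v) (s v) (t v)).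
Proof.
intros Hr Hs Ht; apply D0_iff with (Q := fun v => exists a, a ∈ r v /\
  exists b, b ∈ r v /\
    ((s v ∈ a /\ (forall z, z ∈ a -> z = s v)) /\
     (s v ∈ b /\ t v ∈ b /\ (forall z, z ∈ b -> z = s v \/ z = t v)) /\
     (forall z, z ∈ r v -> z = a \/ z = b))).
- intros v; split.
  + intros (a & b & Ha & Hb & Hab); exists a; split; [apply Hab; auto|].
    exists b; split; [apply Hab; auto|].
    repeat split; intros; try apply Ha; try apply Hb; try apply Hab; auto.
  + intros (a & Ha & b & Hb & (H1 & H2) & (H3 & H4 & H5) & H6).
    exists a, b; repeat split; auto; intros; try (subst; auto).
    * destruct H; subst; auto.
    * destruct H; subst; auto.
- d0.
Qed.

Lemma D0_rel_of r s t :
  is_term r -> is_term s -> is_term t -> D0 (fun v => rel_of (r v) (s v) (t v)).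
Proof.
intros Hr Hs Ht; apply D0_iff with
  (Q := fun v => exists p, p ∈ r v /\ is_opair p (s v) (t v)).
- intros v; unfold rel_of; firstorder.
- apply (D0_ex (t := r)); auto.
  apply (@D0_is_opair (fun v => v 0) (fun v => s (fun n => v (S n)))
    (fun v => t (fun n => v (S n)))); d0_term.
Qed.

Lemma D0_is_succ s t :
  is_term s -> is_term t -> D0 (fun v => is_succ (s v) (t v)).
Proof.
intros Hs Ht; apply D0_iff with (Q := fun v =>
  (forall z, z ∈ s v -> z ∈ t v \/ z = t v) /\
  (forall z, z ∈ t v -> z ∈ s v) /\ t v ∈ s v).
- intros v; split.
  + intros H; repeat split; intros; apply H; auto.
  + intros (H1 & H2 & H3) z; split; auto; intros [Hz| ->]; auto.
- d0.
Qed.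

End DefinableNotions.

Ltac d0_atom ::=
  lazymatch goal with
  | |- D0 (fun v => transitive_set (@?t v)) =>
      apply (@D0_transitive_set _ t); d0_term
  | |- D0 (fun v => is_opair (@?r v) (@?s v) (@?t v)) =>
      apply (@D0_is_opair _ r s t); d0_term
  | |- D0 (fun v => rel_of (@?r v) (@?s v) (@?t v)) =>
      apply (@D0_rel_of _ r s t); d0_term
  | |- D0 (fun v => is_succ (@?s v) (@?t v)) =>
      apply (@D0_is_succ _ s t); d0_term
  end.

(** * Set theory inside a model of MOST *)

Section InternalSets.
Variables (M : structure) (hM : models_MOST M).
Implicit Types (a b c d p r s t u x y z : M).

Lemma set_ext x y : (forall z, z ∈ x <-> z ∈ y) -> x = y.
Proof. apply (Mac_extensionality (MOST_Mac hM)). Qed.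

Lemma comprehension a (P : M -> Prop) : D0 (fun v => P (v 0)) ->
  exists b, forall x, x ∈ b <-> x ∈ a /\ P x.
Proof.
intros HP; destruct (D0_bind HP) as (p & e & Hp & He); simpl in He.
(* [P] reads variable 0 alone, so the other values are arbitrary. *)
assert (v : nat -> M) by exact (fun _ => a).
destruct (Mac_Delta0_separation (MOST_Mac hM) Hp (fun i => ev (e i) v) a) as [b Hb].
exists b; intros x; now rewrite Hb, (He x v).
Qed.

Lemma comprehension_ex a (R : M -> M -> Prop) : D0 (fun v => R (v 1) (v 0)) ->
  exists b, forall x, x ∈ b <-> x ∈ a /\ exists y, R x y.
Proof.
intros HR; destruct (D0_bind2 HR) as (p & e & Hp & He); simpl in He.
assert (v : nat -> M) by exact (fun _ => a).
destruct (MOST_Sigma1_separation hM (p := fEx p)) with (v := fun i => ev (e i) v)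
  (a := a) as [b Hb].
{ now do 2 constructor. }
exists b; intros x; rewrite Hb; simpl.
split; intros [Hx [y Hy]]; (split; [auto|exists y]);
  [apply (He x y v)|apply (He x y v) in Hy]; auto.
Qed.

Lemma collect a (R : M -> M -> Prop) : D0 (fun v => R (v 1) (v 0)) ->
  (forall x, x ∈ a -> exists y, R x y) ->
  exists b, forall x, x ∈ a -> exists y, y ∈ b /\ R x y.
Proof.
intros HR; destruct (D0_bind2 HR) as (p & e & Hp & He); simpl in He; intros H.
assert (v : nat -> M) by exact (fun _ => a).
destruct (MOST_Delta0_collection hM Hp (v := fun i => ev (e i) v) (a := a))
  as [b Hb].
- intros x Hx; destruct (H x Hx) as [y Hy]; exists y; now apply (He x y v).
- exists b; intros x Hx; destruct (Hb x Hx) as (y & Hy & Hxy).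
  exists y; split; auto; now apply (He x y v).
Qed.

(** Foundation yields a minimal element of the set of counterexamples in [a]. *)
Lemma set_induction a (P : M -> Prop) : D0 (fun v => P (v 0)) ->
  (forall x, x ∈ a -> (forall y, y ∈ x -> y ∈ a -> P y) -> P x) ->
  forall x, x ∈ a -> P x.
Proof.
intros HP H x Hx; apply NNPP; intros N.
destruct (comprehension a (P := fun x => ~ P x)) as [b Hb]; [now apply D0_not|].
destruct (Mac_foundation (MOST_Mac hM) (x := b)) as (y & Hy & Hmin).
{ exists x; now apply Hb. }
apply Hb in Hy; destruct Hy as [Hya Hy]; apply Hy, H; auto.
intros z Hzy Hza; apply NNPP; intros Nz; apply Hmin; exists z.
split; auto; now apply Hb.
Qed.

Lemma upair_exists a b : exists c, is_upair c a b.
Proof. apply (Mac_pairing (MOST_Mac hM)). Qed.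

Lemma singleton_exists a : exists c, is_singleton c a.
Proof.
destruct (upair_exists a a) as [c Hc]; exists c; intros z; rewrite (Hc z); tauto.
Qed.

Lemma union_exists a : exists u, is_union u a.
Proof. apply (Mac_union (MOST_Mac hM)). Qed.

Lemma powerset_exists a : exists b, is_powerset b a.
Proof. apply (Mac_powerset (MOST_Mac hM)). Qed.

Lemma cup_exists a b : exists u, forall z, z ∈ u <-> z ∈ a \/ z ∈ b.
Proof.
destruct (upair_exists a b) as [c Hc], (union_exists c) as [u Hu].
exists u; intros z; rewrite (Hu z); split.
- intros (y & Hy & Hz); apply Hc in Hy; destruct Hy; subst; auto.
- intros [Hz|Hz]; [exists a|exists b]; rewrite (Hc _); auto.
Qed.

Lemma adjoin_exists a b : exists u, forall z, z ∈ u <-> z ∈ a \/ z = b.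
Proof.
destruct (singleton_exists b) as [c Hc], (cup_exists a c) as [u Hu].
exists u; intros z; now rewrite Hu, (Hc z).
Qed.

Lemma mem_asym a b : a ∈ b -> b ∈ a -> False.
Proof.
intros Hab Hba; destruct (upair_exists a b) as [c Hc].
destruct (Mac_foundation (MOST_Mac hM) (x := c)) as (y & Hy & Hmin).
- exists a; apply Hc; auto.
- apply Hc in Hy; apply Hmin; destruct Hy; subst y;
    [exists b|exists a]; rewrite (Hc _); auto.
Qed.

Lemma succ_inj a b s : is_succ s a -> is_succ s b -> a = b.
Proof.
intros Ha Hb.
assert (H1 : a ∈ s) by (apply Ha; auto).
assert (H2 : b ∈ s) by (apply Hb; auto).
apply Hb in H1; apply Ha in H2; destruct H1 as [H1|H1], H2 as [H2|H2]; auto.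
destruct (mem_asym H1 H2).
Qed.

Lemma opair_exists a b : exists p, is_opair p a b.
Proof.
destruct (singleton_exists a) as [s Hs], (upair_exists a b) as [t Ht].
destruct (upair_exists s t) as [p Hp]; exists p, s, t; auto.
Qed.

Lemma opair_unique p q a b : is_opair p a b -> is_opair q a b -> p = q.
Proof.
intros (s & t & Hs & Ht & Hp) (s' & t' & Hs' & Ht' & Hq).
assert (s = s') by (apply set_ext; intros z; now rewrite (Hs z), (Hs' z)).
assert (t = t') by (apply set_ext; intros z; now rewrite (Ht z), (Ht' z)).
subst; apply set_ext; intros z; now rewrite (Hp z), (Hq z).
Qed.

Lemma opair_inj p a b c d : is_opair p a b -> is_opair p c d -> a = c /\ b = d.
Proof.
intros (s & t & Hs & Ht & Hp) (s' & t' & Hs' & Ht' & Hp').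
assert (Eac : a = c).
{ assert (H : s' ∈ p) by (apply Hp'; auto); apply Hp in H.
  destruct H; subst s'.
  - symmetry; apply Hs, Hs'; auto.
  - apply Hs', Ht; auto. }
subst c; split; auto.
assert (H : t ∈ p) by (apply Hp; auto); apply Hp' in H.
assert (H' : t' ∈ p) by (apply Hp'; auto); apply Hp in H'.
assert (Hb : b ∈ t) by (apply Ht; auto).
assert (Hd : d ∈ t') by (apply Ht'; auto).
assert (b = a \/ b = d).
{ destruct H; subst t; [left; now apply Hs'|now apply Ht']. }
assert (d = a \/ d = b).
{ destruct H'; subst t'; [left; now apply Hs|now apply Ht]. }
intuition congruence.
Qed.

Lemma opair_in_powerset x y p a b c : is_opair p x y -> x ∈ a -> y ∈ a ->
  is_powerset b a -> is_powerset c b -> p ∈ c.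
Proof.
intros (s & t & Hs & Ht & Hp) Hx Hy Hb Hc; apply Hc; intros z Hz; apply Hb.
intros w Hw; apply Hp in Hz; destruct Hz; subst z.
- apply Hs in Hw; now subst.
- apply Ht in Hw; destruct Hw; now subst.
Qed.

(** Kuratowski pairs of elements of [a ∪ b] lie in its double powerset, from which the relation is
    separated. *)
Lemma relation_comprehension a b (R : M -> M -> Prop) :
  D0 (fun v => R (v 0) (v 1)) ->
  exists r, (forall x y, rel_of r x y <-> x ∈ a /\ y ∈ b /\ R x y) /\
    (forall p, p ∈ r -> exists x y, x ∈ a /\ y ∈ b /\ is_opair p x y).
Proof.
intros HR; destruct (cup_exists a b) as [u Hu].
destruct (powerset_exists u) as [u1 Hu1], (powerset_exists u1) as [u2 Hu2].
destruct (comprehension u2 (P := fun p => exists x, x ∈ a /\ exists y, y ∈ b /\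
  (is_opair p x y /\ R x y))) as [r Hr].
{ d0. }
exists r; split.
- intros x y; split.
  + intros (p & Hp & Hpr); apply Hr in Hpr.
    destruct Hpr as (_ & x' & Hx & y' & Hy & Hp' & Hxy).
    destruct (opair_inj Hp Hp'); subst; auto.
  + intros (Hx & Hy & Hxy); destruct (opair_exists x y) as [p Hp].
    exists p; split; auto; apply Hr; split; [|eauto 10].
    apply (opair_in_powerset Hp (a := u) (b := u1)); auto; apply Hu; auto.
- intros p Hp; apply Hr in Hp.
  destruct Hp as (_ & x & Hx & y & Hy & Hp & _); eauto.
Qed.

Lemma range_exists r : exists b, forall x y, rel_of r x y -> y ∈ b.
Proof.
destruct (union_exists r) as [u Hu], (union_exists u) as [b Hb].
exists b; intros x y (p & (s & t & Hs & Ht & Hp) & Hpr).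
apply Hb; exists t; split; [|apply Ht; auto].
apply Hu; exists p; split; auto; apply Hp; auto.
Qed.

(** The closure is the intersection of the transitive supersets of [a] among the subsets of one
    transitive [b]. An arbitrary transitive superset [u] is compared with it through [u ∩ b]. *)
Lemma transitive_hull a : exists t, is_TC t a.
Proof.
destruct (Mac_transitive_containment (MOST_Mac hM) a) as (b & Hb & Hab).
destruct (powerset_exists b) as [b' Hb'].
destruct (comprehension b (P := fun z => forall w, w ∈ b' -> transitive_set w ->
  incl a w -> z ∈ w)) as [t Ht]; [d0|].
exists t; split; [|split].
- intros y z Hy Hz; apply Ht in Hy; destruct Hy as [Hyb Hy]; apply Ht.
  split; [now apply (Hb y)|intros w Hw Tw Iw; apply (Tw y z); auto].
- intros x Hx; apply Ht; split; auto.
- intros u Tu Iu z Hz; apply Ht in Hz; destruct Hz as [Hzb Hz].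
  destruct (comprehension b (P := fun x => x ∈ u)) as [w Hw]; [d0|].
  apply Hw, Hz.
  + apply Hb'; intros x Hx; now apply Hw.
  + intros x y Hx Hy; apply Hw in Hx; apply Hw; destruct Hx; split;
      [apply (Hb x)|apply (Tu x)]; auto.
  + intros x Hx; apply Hw; auto.
Qed.

Lemma transitive_cup a b u : transitive_set a -> transitive_set b ->
  (forall z, z ∈ u <-> z ∈ a \/ z ∈ b) -> transitive_set u.
Proof.
intros Ta Tb Hu x y Hx Hy; apply Hu in Hx; apply Hu.
destruct Hx; [left; apply (Ta x)|right; apply (Tb x)]; auto.
Qed.

(** A finite union of transitive sets. It is applied with [J] being [I_fix] to enclose the
    parameters, and with a trivial [J] to enclose all relevant values. *)
Lemma transitive_sup (J : M -> Prop) (S : nat -> Prop) (v : nat -> M) a k :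
  (forall x y u, J x -> J y -> (forall z, z ∈ u <-> z ∈ x \/ z ∈ y) -> J u) ->
  (forall i, S i -> exists u, J u /\ transitive_set u /\ v i ∈ u) ->
  J a -> transitive_set a ->
  exists b, J b /\ transitive_set b /\ incl a b /\ forall i, i < k -> S i -> v i ∈ b.
Proof.
intros HJ HS Ha Ta; induction k as [|k (b & Jb & Tb & Ib & Hb)].
- exists a; repeat split; auto; [now intros x|intros; lia].
- destruct (classic (S k)) as [Sk|Sk].
  + destruct (HS k Sk) as (u & Ju & Tu & Hu), (cup_exists b u) as [c Hc].
    exists c; repeat split; [now apply (HJ b u)|now apply (transitive_cup Tb Tu)| |].
    * intros x Hx; apply Hc; auto.
    * intros i Hi Si; apply Hc; destruct (Nat.eq_dec i k); [subst; auto|].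
      left; apply Hb; auto; lia.
  + exists b; repeat split; auto; intros i Hi Si.
    destruct (Nat.eq_dec i k); [now subst|apply Hb; auto; lia].
Qed.

End InternalSets.

(** * Transitive collapse *)

Section Collapse.
Variables (M : structure) (hM : models_MOST M).
Implicit Types (a b c d h p r s t u x y z : M) (E : M -> M -> Prop).

(** The recursion equation [h(x) = {h(x') : E x' x}] for a relation [h] that may be many-valued; its
    domain is closed under [E]-predecessors. Single-valuedness is the case [h = h'] of
    [collapses_unique]. *)
Definition collapses E h : Prop := forall x y, rel_of h x y ->
  (forall x', E x' x -> exists y', y' ∈ y /\ rel_of h x' y') /\
  (forall y', y' ∈ y -> exists x', E x' x /\ rel_of h x' y').

Lemma domain_exists r : exists b, forall x y, rel_of r x y -> x ∈ b.
Proof.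
destruct (union_exists hM r) as [u Hu], (union_exists hM u) as [b Hb].
exists b; intros x y (p & (s & t & Hs & Ht & Hp) & Hpr).
apply Hb; exists s; split; [|apply Hs; auto].
apply Hu; exists p; split; auto; apply Hp; auto.
Qed.

(** The induction runs over the value [y], where membership is well-founded by the axiom of
    foundation, and so asks nothing of [E]. *)
Lemma collapses_unique E h h' x y y' : collapses E h -> collapses E h' ->
  rel_of h x y -> rel_of h' x y' -> y = y'.
Proof.
intros Ch Ch' Hxy Hxy'.
destruct (domain_exists h) as [dh Hd], (range_exists hM h) as [b Hb].
destruct (range_exists hM h') as [b' Hb'].
(* With all quantifiers bounded by sets the induction predicate is Δ0. *)
assert (H : forall y, y ∈ b -> forall x, x ∈ dh -> forall y', y' ∈ b' ->
  rel_of h x y -> rel_of h' x y' -> y = y'); [|eauto].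
clear x y y' Hxy Hxy'.
refine (@set_induction M hM _ _ _ _); [d0|].
intros y _ IH x _ y' _ Hxy Hxy'; apply (set_ext hM); intros z; split; intros Hz.
- destruct (Ch x y Hxy) as [_ C2]; destruct (C2 z Hz) as (x1 & Hx1 & Hz1).
  destruct (Ch' x y' Hxy') as [C1 _]; destruct (C1 x1 Hx1) as (z' & Hz' & Hz2).
  assert (z = z') by eauto; now subst.
- destruct (Ch' x y' Hxy') as [_ C2]; destruct (C2 z Hz) as (x1 & Hx1 & Hz1).
  destruct (Ch x y Hxy) as [C1 _]; destruct (C1 x1 Hx1) as (z' & Hz' & Hz2).
  assert (z' = z) by eauto; now subst.
Qed.

Lemma opair_components p x y : is_opair p x y ->
  exists s, s ∈ p /\ x ∈ s /\ exists t, t ∈ p /\ y ∈ t.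
Proof.
intros (s & t & Hs & Ht & Hp); exists s; repeat split.
- apply Hp; auto.
- apply Hs; auto.
- exists t; split; [apply Hp|apply Ht]; auto.
Qed.

Variable N : M.

Let E x' x : Prop := x' ∈ x /\ x' ∈ N.

Let attempt h x : Prop := collapses E h /\ exists y, rel_of h x y.

Lemma D0_attempt : D0 (fun v => attempt (v 0) (v 1)).
Proof.
apply D0_iff with (Q := fun v =>
  (forall p, p ∈ v 0 -> forall s, s ∈ p -> forall x, x ∈ s ->
   forall t, t ∈ p -> forall y, y ∈ t -> is_opair p x y ->
     (forall x', x' ∈ x -> x' ∈ N -> exists y', y' ∈ y /\ rel_of (v 0) x' y') /\
     (forall y', y' ∈ y -> exists x', x' ∈ x /\ (x' ∈ N /\ rel_of (v 0) x' y'))) /\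
  exists p, p ∈ v 0 /\ exists t, t ∈ p /\ exists y, y ∈ t /\ is_opair p (v 1) y).
- intros v; split; intros [H1 H2]; split.
  + intros p Hp s _ x _ t _ y _ Hxy.
    destruct (H1 x y) as [C1 C2]; [now exists p|]; split.
    * intros x' Hx' HN; now apply C1.
    * intros y' Hy'; destruct (C2 y' Hy') as (x' & [? ?] & ?); eauto.
  + destruct H2 as (y & p & Hp & Hpv); exists p; split; auto.
    destruct (opair_components Hp) as (_ & _ & _ & t & Ht & Hy); eauto.
  + intros x y (p & Hp & Hpv).
    destruct (opair_components Hp) as (s & Hs & Hx & t & Ht & Hy).
    destruct (H1 p Hpv s Hs x Hx t Ht y Hy Hp) as [C1 C2]; split.
    * intros x' [Hx' HN]; now apply C1.
    * intros y' Hy'; destruct (C2 y' Hy') as (x' & ? & ? & ?).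
      exists x'; repeat split; auto.
  + destruct H2 as (p & Hp & t & _ & y & _ & Hy); exists y, p; auto.
- d0.
Qed.

(** Δ0-collection gathers attempts for all elements of [a]. Their union is again an attempt without
    any check of compatibility, as [collapses] is preserved by unions. *)
Lemma attempt_union a : (forall x, x ∈ a -> exists h, attempt h x) ->
  exists h, collapses E h /\ forall x, x ∈ a -> exists y, rel_of h x y.
Proof.
intros H; destruct (collect hM (R := fun x h => attempt h x) (a := a)) as [b Hb]; auto.
{ exact D0_attempt. }
(* The collecting set may have other elements as well; only the attempts are kept. *)
destruct (comprehension hM b (P := fun h => exists x, x ∈ a /\ attempt h x))
  as [b' Hb'].
{ pose proof D0_attempt; d0. }
destruct (union_exists hM b') as [u Hu].
assert (Hr : forall x y, rel_of u x y <-> exists h, h ∈ b' /\ rel_of h x y).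
{ intros x y; split.
  - intros (p & Hp & Hpu); apply Hu in Hpu; destruct Hpu as (h & Hh & Hph).
    exists h; split; auto; now exists p.
  - intros (h & Hh & p & Hp & Hph); exists p; split; auto; apply Hu; eauto. }
exists u; split.
- intros x y Hxy; apply Hr in Hxy; destruct Hxy as (h & Hh & Hxy).
  assert (Hh' := Hh); apply Hb' in Hh'; destruct Hh' as (_ & _ & _ & Ch & _).
  destruct (Ch x y Hxy) as [C1 C2]; split.
  + intros x' Hx'; destruct (C1 x' Hx') as (y' & Hy' & Hxy').
    exists y'; split; auto; apply Hr; eauto.
  + intros y' Hy'; destruct (C2 y' Hy') as (x' & Hx' & Hxy').
    exists x'; split; auto; apply Hr; eauto.
- intros x Hx; destruct (Hb x Hx) as (h & Hh & Ch & y & Hy).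
  exists y; apply Hr; exists h; split; auto; apply Hb'; split; auto.
  exists x; repeat split; eauto; apply Ch; auto.
Qed.

(** Only predecessors are restricted to [N], so the collapse is defined on the whole of [a]. *)
Lemma collapse_exists a : transitive_set a -> exists h,
  collapses (fun x' x => x' ∈ x /\ x' ∈ N) h /\
  forall x, x ∈ a -> exists y, rel_of h x y.
Proof.
intros Ta; apply attempt_union.
(* Having an attempt is a Σ1 property. Σ1-separation turns it into membership in a set [s], for
   which induction is available. *)
destruct (comprehension_ex hM a (R := fun x h => attempt h x)) as [s Hs].
{ exact D0_attempt. }
assert (H : forall x, x ∈ a -> x ∈ s); [|intros x Hx; now apply Hs, H].
refine (@set_induction M hM _ _ _ _); [d0|].
intros x Hx IH; apply Hs; split; auto.
destruct (attempt_union (a := x)) as (h & Ch & Dh).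
{ intros y Hy; apply Hs, IH; auto; now apply (Ta x). }
destruct (range_exists hM h) as [b Hb].
destruct (comprehension hM b (P := fun y' => exists x', x' ∈ x /\
  (x' ∈ N /\ rel_of h x' y'))) as [y Hy]; [d0|].
(* An attempt covering the elements of [x] is extended by the pair of [x] and the set of values at
   [x ∩ N]. *)
destruct (opair_exists hM x y) as [p Hp], (adjoin_exists hM h p) as [h1 Hh1].
assert (Hr : forall c d, rel_of h1 c d <-> rel_of h c d \/ c = x /\ d = y).
{ intros c d; split.
  - intros (q & Hq & Hqh); apply Hh1 in Hqh; destruct Hqh as [Hqh| ->].
    + left; now exists q.
    + right; exact (opair_inj Hq Hp).
  - intros [(q & Hq & Hqh)|[-> ->]].
    + exists q; split; auto; apply Hh1; auto.
    + exists p; split; auto; apply Hh1; auto. }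
exists h1; split; [|exists y; apply Hr; auto].
intros c d Hcd; apply Hr in Hcd; destruct Hcd as [Hcd|[-> ->]].
- destruct (Ch c d Hcd) as [C1 C2]; split.
  + intros x' Hx'; destruct (C1 x' Hx') as (y' & Hy' & Hxy').
    exists y'; split; auto; apply Hr; auto.
  + intros y' Hy'; destruct (C2 y' Hy') as (x' & Hx' & Hxy').
    exists x'; split; auto; apply Hr; auto.
- split.
  + intros x' [Hx' HN]; destruct (Dh x' Hx') as [y' Hxy'].
    exists y'; split; [apply Hy; eauto 10|apply Hr; auto].
  + intros y' Hy'; apply Hy in Hy'; destruct Hy' as (_ & x' & Hx' & HN & Hxy').
    exists x'; split; [now split|apply Hr; auto].
Qed.

End Collapse.

(** * The elements hereditarily fixed by an automorphism *)

Section Automorphism.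
Variables (M : structure) (hM : models_MOST M) (j : M -> M) (hj : automorphism j).
Implicit Types (a b c d p r s t u x y z : M).

Lemma aut_mem x y : x ∈ y <-> j x ∈ j y.
Proof. apply hj. Qed.

Lemma aut_surj y : exists x, j x = y.
Proof. destruct hj as [(g & _ & Hg) _]; exists (g y); apply Hg. Qed.

Lemma aut_inj x y : j x = j y -> x = y.
Proof.
destruct hj as [(g & Hg & _) _]; intros H; now rewrite <- (Hg x), H, Hg.
Qed.

Lemma aut_upair p a b : is_upair p a b -> is_upair (j p) (j a) (j b).
Proof.
intros H z; destruct (aut_surj z) as [x <-]; rewrite <- aut_mem, (H x).
split; intros [E|E]; [left; now subst|right; now subst| |];
  apply aut_inj in E; auto.
Qed.

Lemma aut_opair p a b : is_opair p a b -> is_opair (j p) (j a) (j b).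
Proof.
assert (Hs : forall s c, is_singleton s c <-> is_upair s c c).
{ intros s c; split; intros H z; rewrite (H z); tauto. }
intros (s & t & H1 & H2 & H3); exists (j s), (j t); rewrite Hs in *.
auto using aut_upair.
Qed.

Lemma aut_rel_of r a b : rel_of (j r) (j a) (j b) <-> rel_of r a b.
Proof.
split.
- intros (q & Hq & Hqr); destruct (opair_exists hM a b) as [p Hp].
  exists p; split; auto; apply aut_mem.
  now rewrite (opair_unique hM (aut_opair Hp) Hq).
- intros (p & Hp & Hpr); exists (j p); split; [now apply aut_opair|].
  now rewrite <- aut_mem.
Qed.

(** TC({x}) is itself such a [u], and every such [u] includes it; closures need not be computed from
    here on. *)
Lemma I_fix_iff x : I_fix j x <->
  exists u, transitive_set u /\ x ∈ u /\ forall y, y ∈ u -> j y = y.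
Proof.
split.
- intros H; destruct (singleton_exists hM x) as [s Hs].
  destruct (transitive_hull hM s) as [t Ht]; assert (Ht' := Ht).
  destruct Ht' as (Tt & It & _); exists t; split; auto; split.
  + apply It, Hs; auto.
  + intros y Hy; apply H; exists s, t; auto.
- intros (u & Tu & Hx & Hu) y (s & t & Hs & (_ & _ & Ht) & Hy).
  apply Hu, Ht; auto; intros z Hz; apply Hs in Hz; now subst.
Qed.

Lemma I_fix_fixed x : I_fix j x -> j x = x.
Proof. rewrite I_fix_iff; intros (u & _ & Hx & Hu); auto. Qed.

Lemma I_fix_mem x y : I_fix j x -> y ∈ x -> I_fix j y.
Proof.
rewrite !I_fix_iff; intros (u & Tu & Hx & Hu) Hy; exists u; repeat split; auto.
now apply (Tu x).
Qed.

Lemma aut_fixed_of_elements c : (forall x, x ∈ c -> j x = x) -> j c = c.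
Proof.
intros H; apply (set_ext hM); intros z; split; intros Hz.
- destruct (aut_surj z) as [x <-]; rewrite <- aut_mem in Hz; now rewrite (H x).
- rewrite <- (H z Hz); now rewrite <- aut_mem.
Qed.

(* The transitive closures of the singletons [{x}] for [x ∈ c] are uniformly
   definable inside the transitive closure of [c], hence have a union. *)
Lemma I_fix_of_elements c : (forall x, x ∈ c -> I_fix j x) -> I_fix j c.
Proof.
intros H; destruct (transitive_hull hM c) as (t & Tt & It & _).
destruct (powerset_exists hM t) as [t' Ht'].
destruct (comprehension hM t (P := fun y => exists x, x ∈ c /\
  forall w, w ∈ t' -> transitive_set w -> x ∈ w -> y ∈ w)) as [u Hu]; [d0|].
assert (Fu : forall y, y ∈ u -> j y = y).
{ intros y Hy; apply Hu in Hy; destruct Hy as (Hyt & x & Hx & Hy).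
  assert (Ix := H x Hx); apply I_fix_iff in Ix; destruct Ix as (w & Tw & Hxw & Fw).
  (* The set [w] may leave [t]; its trace on [t] is still transitive and contains [x]. *)
  destruct (comprehension hM t (P := fun z => z ∈ w)) as [w' Hw']; [d0|].
  apply Fw, Hw', Hy.
  - apply Ht'; intros z Hz; now apply Hw'.
  - intros a b Ha Hb; apply Hw' in Ha; apply Hw'; destruct Ha; split;
      [apply (Tt a)|apply (Tw a)]; auto.
  - apply Hw'; auto. }
assert (Iu : incl c u).
{ intros x Hx; apply Hu; split; [auto|exists x; auto]. }
destruct (adjoin_exists hM u c) as [u1 Hu1].
apply I_fix_iff; exists u1; split; [|split].
- intros a b Ha Hb; apply Hu1 in Ha; apply Hu1; left.
  destruct Ha as [Ha| ->]; [|auto].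
  apply Hu in Ha; apply Hu; destruct Ha as (Ha & x & Hx & Hxa); split.
  + now apply (Tt a).
  + exists x; split; auto; intros w Hw Tw Hxw; apply (Tw a); auto.
- apply Hu1; auto.
- intros y Hy; apply Hu1 in Hy; destruct Hy as [Hy| ->]; auto.
  apply aut_fixed_of_elements; auto.
Qed.

Lemma I_fix_subset x y : I_fix j y -> incl x y -> I_fix j x.
Proof. intros Hy H; apply I_fix_of_elements; intros; apply (I_fix_mem Hy); auto. Qed.

Lemma I_fix_upair p a b : is_upair p a b -> I_fix j a -> I_fix j b -> I_fix j p.
Proof.
intros H Ha Hb; apply I_fix_of_elements; intros x Hx; apply H in Hx.
destruct Hx; now subst.
Qed.

Lemma I_fix_opair p a b : is_opair p a b -> I_fix j a -> I_fix j b -> I_fix j p.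
Proof.
intros (s & t & Hs & Ht & Hp) Ha Hb; apply (I_fix_upair Hp).
- apply I_fix_of_elements; intros x Hx; apply Hs in Hx; now subst.
- now apply (I_fix_upair Ht).
Qed.

Lemma I_fix_cup x y u : I_fix j x -> I_fix j y ->
  (forall z, z ∈ u <-> z ∈ x \/ z ∈ y) -> I_fix j u.
Proof.
intros Hx Hy Hu; apply I_fix_of_elements; intros z Hz; apply Hu in Hz.
destruct Hz; eauto using I_fix_mem.
Qed.

Lemma I_fix_powerset x y : is_powerset y x -> I_fix j x -> I_fix j y.
Proof.
intros H Hx; apply I_fix_of_elements; intros z Hz; apply H in Hz.
now apply (I_fix_subset Hx).
Qed.

Lemma I_fix_transitive_witness x : I_fix j x ->
  exists u, I_fix j u /\ transitive_set u /\ x ∈ u.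
Proof.
rewrite I_fix_iff; intros (u & Tu & Hx & Hu); exists u; repeat split; auto.
apply I_fix_of_elements; intros y Hy; apply I_fix_iff; eauto.
Qed.

(* The collapse of a well-founded relation is unique, so [j] maps the collapse
   of the fixed relation [r] to itself. *)
Lemma I_fix_collapse d r g : I_fix j d ->
  (forall p, p ∈ r -> exists x y, x ∈ d /\ y ∈ d /\ is_opair p x y) ->
  collapses (rel_of r) g -> (forall x y, rel_of g x y -> x ∈ d) ->
  forall x y, rel_of g x y -> I_fix j y.
Proof.
intros Hd Hr Cg Dg.
assert (Ir : I_fix j r).
{ apply I_fix_of_elements; intros p Hp; destruct (Hr p Hp) as (x & y & Hx & Hy & Hp').
  apply (I_fix_opair Hp'); eauto using I_fix_mem. }
assert (Er : j r = r) by now apply I_fix_fixed.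
assert (Fd : forall x, x ∈ d -> j x = x).
{ intros x Hx; apply I_fix_fixed, (I_fix_mem Hd Hx). }
assert (Cj : collapses (rel_of r) (j g)).
{ intros x' y' H.
  destruct (aut_surj x') as [x <-], (aut_surj y') as [y <-].
  rewrite aut_rel_of in H; destruct (Cg x y H) as [C1 C2]; split.
  - intros c' Hc; destruct (aut_surj c') as [c <-].
    rewrite <- Er in Hc; rewrite aut_rel_of in Hc.
    destruct (C1 c Hc) as (z & Hz & Hcz); exists (j z).
    split; [now rewrite <- aut_mem|now rewrite aut_rel_of].
  - intros z' Hz; destruct (aut_surj z') as [z <-]; rewrite <- aut_mem in Hz.
    destruct (C2 z Hz) as (c & Hc & Hcz); exists (j c).
    split; [rewrite <- Er|]; now rewrite aut_rel_of. }
assert (Fg : forall x y, rel_of g x y -> j y = y).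
{ intros x y Hxy; apply (collapses_unique hM Cj Cg (x := x)); auto.
  rewrite <- (Fd x) by eauto; now rewrite aut_rel_of. }
destruct (range_exists hM g) as [b Hb].
(* The set of all values of [g] is transitive and consists of fixed points. *)
destruct (comprehension hM b (P := fun y => exists x, x ∈ d /\ rel_of g x y))
  as [u Hu]; [d0|].
intros x y Hxy; apply I_fix_iff; exists u; repeat split.
- intros a c Ha Hc; apply Hu in Ha; destruct Ha as (_ & x' & _ & Hx').
  destruct (Cg x' a Hx') as [_ C2]; destruct (C2 c Hc) as (x1 & _ & Hx1).
  apply Hu; split; [|exists x1; split]; eauto.
- apply Hu; split; [|exists x; split]; eauto.
- intros z Hz; apply Hu in Hz; destruct Hz as (_ & x' & _ & Hx'); eauto.
Qed.

End Automorphism.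

(** * Coding tuples of sets of subsets *)

Section Codes.
Variables (M : structure) (hM : models_MOST M).
Implicit Types (a b c d e n m p r s t w x y z : M) (u v : nat -> M).
Variables (omega zero A W D : M).
Hypotheses (Homega : inductive_set omega) (Hzero : is_empty zero)
  (HomegaA : incl omega A) (HW : is_powerset W A) (HD : is_powerset D W).

Lemma zero_omega : zero ∈ omega.
Proof.
destruct Homega as [(z & Hz & Hzo) _].
replace zero with z; auto; apply (set_ext hM); intros x; split; intros Hx;
  [destruct (Hz x Hx)|destruct (Hzero Hx)].
Qed.

Lemma succ_omega n : n ∈ omega -> exists m, m ∈ omega /\ is_succ m n.
Proof. intros Hn; destruct Homega as [_ H]; destruct (H n Hn) as (m & ? & ?); eauto. Qed.

Lemma omega_succ n m : n ∈ omega -> is_succ m n -> m ∈ omega.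
Proof.
intros Hn Hm; destruct (succ_omega Hn) as (m' & Hm' & Hs).
replace m with m'; auto; apply (set_ext hM); intros z; now rewrite (Hm z), (Hs z).
Qed.

(** For [y ⊆ A], the set obtained from [y] by shifting its part in ω by one;
    the vacated place [0] stores the bit [i]. *)
Definition shift (i : bool) y z : Prop :=
  (zero ∈ z <-> i = true) /\
  (forall n, n ∈ omega -> forall m, m ∈ omega -> is_succ m n -> (n ∈ y <-> m ∈ z)) /\
  (forall x, x ∈ A -> ~ x ∈ omega -> (x ∈ y <-> x ∈ z)).

Lemma shift_inj i i' y y' z : y ∈ W -> y' ∈ W ->
  shift i y z -> shift i' y' z -> i = i' /\ y = y'.
Proof.
intros Hy Hy' (H1 & H2 & H3) (H1' & H2' & H3'); split.
- destruct i, i'; auto; [symmetry|]; tauto.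
- assert (E : forall x, x ∈ A -> (x ∈ y <-> x ∈ y')).
  { intros x Hx; destruct (classic (x ∈ omega)) as [Ho|Ho].
    - destruct (succ_omega Ho) as (m & Hm & Hs).
      now rewrite (H2 x Ho m Hm Hs), (H2' x Ho m Hm Hs).
    - now rewrite (H3 x Hx Ho), (H3' x Hx Ho). }
  apply HW in Hy; apply HW in Hy'.
  apply (set_ext hM); intros x; split; intros Hx; apply E; auto.
Qed.

(** The three clauses defining [z] do not interfere: zero is no successor, successor is injective,
    and ω is closed under it. *)
Lemma shift_total i y : y ∈ W -> exists z, z ∈ W /\ shift i y z.
Proof.
intros Hy; apply HW in Hy.
destruct (comprehension hM A (P := fun x => (i = true /\ x = zero) \/
  (exists n, n ∈ omega /\ (n ∈ y /\ is_succ x n)) \/ (x ∈ y /\ ~ x ∈ omega)))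
  as [z Hz]; [d0|].
assert (Z := zero_omega).
exists z; split; [apply HW; intros x Hx; now apply Hz|split; [|split]].
- split.
  + intros H; apply Hz in H; destruct H as (_ & [[? _]|[(n & _ & _ & Hn)|[_ ?]]]); auto.
    destruct (Hzero (z := n)); apply Hn; auto.
  + intros ->; apply Hz; auto.
- intros n Hn m Hm Hs; split.
  + intros Hny; apply Hz; split; [auto|right; left; eauto].
  + intros Hmz; apply Hz in Hmz.
    destruct Hmz as (_ & [[_ E]|[(n' & _ & Hn' & Hs')|[_ ?]]]).
    * destruct (Hzero (z := n)); rewrite <- E; apply Hs; auto.
    * now rewrite (succ_inj hM Hs Hs').
    * contradiction.
- intros x Hx No; split; intros Hxz.
  + apply Hz; auto.
  + apply Hz in Hxz; destruct Hxz as (_ & [[_ E]|[(n & Hn & _ & Hs)|[? _]]]); auto.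
    * subst; contradiction.
    * destruct No; apply (omega_succ Hn Hs).
Qed.

(** The index [i] is written in unary in front of [w]: [i] bits [true], then a closing [false].
    Different indices therefore give disjoint ranges. *)
Fixpoint tag (i : nat) w z : Prop :=
  match i with
  | 0 => shift false w z
  | S i => exists y, y ∈ W /\ (tag i w y /\ shift true y z)
  end.

Lemma D0_tag i : D0 (fun v : nat -> M => tag i (v 0) (v 1)).
Proof. induction i as [|i IH]; simpl; unfold shift; d0. Qed.

Lemma tag_total i w : w ∈ W -> exists z, z ∈ W /\ tag i w z.
Proof.
intros Hw; induction i as [|i (y & Hy & IH)]; simpl; [now apply shift_total|].
destruct (shift_total true Hy) as (z & Hz & Hs); eauto 10.
Qed.

Lemma tag_inj i i' w w' z : w ∈ W -> w' ∈ W ->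
  tag i w z -> tag i' w' z -> i = i' /\ w = w'.
Proof.
intros Hw Hw'; revert i' z; induction i as [|i IH]; intros [|i'] z; simpl.
- intros H H'; now destruct (shift_inj Hw Hw' H H').
- intros H (y & Hy & _ & H'); destruct (shift_inj Hw Hy H H'); discriminate.
- intros (y & Hy & _ & H') H; destruct (shift_inj Hy Hw' H' H); discriminate.
- intros (y & Hy & Ht & Hs) (y' & Hy' & Ht' & Hs').
  destruct (shift_inj Hy Hy' Hs Hs'); subst y'.
  destruct (IH i' y Ht Ht'); auto.
Qed.

(** The component of index [i] is the preimage of [d] under [tag i], so one set [d] carries
    components of all indices. *)
Definition component (i : nat) d e : Prop :=
  forall w, w ∈ W -> (w ∈ e <-> exists z, z ∈ d /\ tag i w z).

Lemma D0_component i : D0 (fun v : nat -> M => component i (v 0) (v 1)).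
Proof. unfold component; pose proof (D0_tag i); d0. Qed.

Lemma component_unique i d e e' : e ∈ D -> e' ∈ D ->
  component i d e -> component i d e' -> e = e'.
Proof.
intros He He' H H'; apply HD in He; apply HD in He'.
apply (set_ext hM); intros w; split; intros Hw;
  [apply H', H|apply H, H']; auto.
Qed.

Lemma tuple_exists k (e : nat -> M) : (forall i, i < k -> e i ∈ D) ->
  exists d, d ∈ D /\ forall i, i < k -> component i d (e i).
Proof.
intros He.
(* The union of the tagged components; the finite disjunction over [i] is a negated conjunction in
   order to fit [D0_bounded_forall]. *)
destruct (comprehension hM W (P := fun z => ~ forall i, i < k ->
  forall w, w ∈ e i -> ~ tag i w z)) as [d Hd].
{ apply D0_not, D0_bounded_forall; intros i; pose proof (D0_tag i); d0. }
exists d; split; [apply HD; intros z Hz; now apply Hd|].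
intros i Hi w Hw; split.
- intros Hwe; destruct (tag_total i Hw) as (z & Hz & Ht); exists z; split; auto.
  apply Hd; split; auto; intros N; exact (N i Hi w Hwe Ht).
- intros (z & Hz & Ht); apply Hd in Hz; destruct Hz as [_ Hz].
  apply NNPP; intros N; apply Hz; intros i' Hi' w' Hw' Ht'.
  assert (w' ∈ W) by (specialize (He i' Hi'); apply HD in He; auto).
  destruct (tag_inj Hw H Ht Ht'); now subst.
Qed.

(** * Skolem hulls *)

Variables (T r : M) (Q : (nat -> M) -> Prop) (k : nat).
Hypotheses (HAT : incl A T) (Hr : well_orders (rel_of r) T)
  (HQ : D0 Q) (Qlocal : local k Q).

(** This says that the union of [e] is {a}. For [a ∈ A] the set {{a}} is such a code in [D]. *)
Definition codes e a : Prop :=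
  (exists s, s ∈ e /\ a ∈ s) /\ forall s, s ∈ e -> forall z, z ∈ s -> z = a.

Definition base d a : Prop := exists e, e ∈ D /\ (component 0 d e /\ codes e a).

Definition least x (u : nat -> M) : Prop :=
  Q (scons x u) /\ forall y, y ∈ T -> Q (scons y u) -> y = x \/ rel_of r x y.

(** The code [d] names [t] outright if its component [0] does; otherwise [d]
    is a Skolem term whose arguments are coded by the components [1, ..., k]. *)
Definition clause (Y : M -> M -> Prop) d t : Prop :=
  (t ∈ A /\ base d t) \/
  ((forall a, a ∈ A -> ~ base d a) /\
   exists u : nat -> M, (forall i, i < k -> u i ∈ T) /\
     (forall i, i < k -> exists e, e ∈ D /\ (component (S i) d e /\ Y e (u i))) /\
     least t u).

Lemma base_fun d a a' : base d a -> base d a' -> a = a'.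
Proof.
intros (e & He & Hc & (s & Hs & Ha) & _) (e' & He' & Hc' & _ & H).
rewrite <- (component_unique He He' Hc Hc') in H; eauto.
Qed.

Lemma least_unique x x' u : x ∈ T -> x' ∈ T -> least x u -> least x' u -> x = x'.
Proof.
intros Hx Hx' [H1 H2] [H1' H2']; destruct Hr as (Irr & Tr & _).
destruct (H2 x' Hx' H1') as [E|E]; auto.
destruct (H2' x Hx H1) as [E'|E']; auto.
destruct (Irr x Hx); eapply Tr; eauto.
Qed.

Lemma least_local x u u' : (forall i, i < k -> u i = u' i) -> least x u -> least x u'.
Proof.
assert (L : forall y v v', (forall i, i < k -> v i = v' i) ->
  Q (scons y v) -> Q (scons y v')).
{ intros y v v' H; apply Qlocal; intros [|i] Hi; auto; apply H; lia. }
intros H [H1 H2]; split; [now apply (L x u)|].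
intros y Hy HQy; apply H2; auto; apply (L y u'); auto; intros; symmetry; auto.
Qed.

Lemma least_exists x u : x ∈ T -> Q (scons x u) -> exists y, y ∈ T /\ least y u.
Proof.
intros Hx HQx.
destruct (comprehension hM T (P := fun y => Q (scons y u))) as [s Hs].
{ revert HQ; apply (@D0_subst _ Q (fun i v => scons (v 0) u i)).
  intros [|i]; simpl; d0_term. }
destruct Hr as (_ & _ & _ & Hw); destruct (Hw s) as (y & Hy & Hmin).
- intros y Hy; now apply Hs.
- exists x; now apply Hs.
- apply Hs in Hy; destruct Hy as [Hy HQy]; exists y; repeat split; auto.
  intros z Hz HQz; apply Hmin, Hs; auto.
Qed.

Lemma D0_clause : D0 (fun v : nat -> M => clause (rel_of (v 0)) (v 1) (v 2)).
Proof.
assert (Hb : D0 (fun v : nat -> M => base (v 0) (v 1))).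
{ unfold base, codes; pose proof (D0_component 0); d0. }
apply D0_or; [d0|apply D0_and; [d0|]].
(* After prepending [u], the relation, the code and the value sit at indices [k], [k + 1] and
   [k + 2]. *)
pose (P (w : nat -> M) := (forall i, i < k -> exists e, e ∈ D /\
    (component (S i) (w (k + 1)) e /\ rel_of (w k) e (w i))) /\
  least (w (k + 2)) w).
apply D0_iff with (Q := fun v => exists u, (forall i, i < k -> u i ∈ T) /\
  P (prepend k u v)).
- assert (E : forall u v i, i < k -> prepend (M := M) k u v i = u i).
  { intros u v i Hi; unfold prepend; destruct (Nat.ltb_spec i k); auto; lia. }
  assert (E' : forall u v i, prepend (M := M) k u v (k + i) = v i).
  { intros u v i; unfold prepend; destruct (Nat.ltb_spec (k + i) k); [lia|].
    f_equal; lia. }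
  assert (E0 : forall u v, prepend (M := M) k u v k = v 0).
  { intros u v; rewrite <- (E' u v 0); f_equal; lia. }
  intros v; split; intros (u & Hu & Hc & Hl); exists u; unfold P in *; repeat split; auto;
    rewrite ?E', ?E0 in *.
  + intros i Hi; rewrite E by auto; now apply Hc.
  + apply (least_local (u := u)); auto; intros; now rewrite E.
  + apply (least_local (u := u)); auto; intros; now rewrite E.
  + intros i Hi; specialize (Hc i Hi); now rewrite E in Hc.
  + apply (least_local (u := prepend k u v)); auto; intros; now rewrite E.
  + apply (least_local (u := prepend k u v)); auto; intros; now rewrite E.
- apply D0_bounded_ex; unfold P; apply D0_and.
  + apply D0_bounded_forall; intros i; pose proof (D0_component (S i)); d0.
  + unfold least; apply D0_and.
    * apply (@D0_subst _ Q (fun i v => scons (v (k + 2)) v i)); auto.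
      intros [|i]; simpl; d0_term.
    * apply (@D0_all _ (fun _ => T) (fun y v => Q (scons y v) ->
        y = v (k + 2) \/ rel_of r (v (k + 2)) y)); [d0_term|].
      apply D0_imp; [|d0].
      apply (@D0_subst _ Q (fun i v => scons (v 0) (fun l => v (S l)) i)); auto.
      intros [|i]; simpl; d0_term.
Qed.

Lemma clause_mono (Y Y' : M -> M -> Prop) d t :
  (forall e x, e ∈ D -> x ∈ T -> Y e x -> Y' e x) -> clause Y d t -> clause Y' d t.
Proof.
intros H [Hb|(Hb & u & Hu & Hc & Hl)]; [now left|right].
split; auto; exists u; repeat split; auto; try apply Hl.
intros i Hi; destruct (Hc i Hi) as (e & He & Hi' & Hy); eauto 10.
Qed.

(** [G] relates names to the elements of the Skolem hull. Minimality is stated against Δ0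
    predicates, so that it serves directly as an induction principle. *)
Definition generated G : Prop :=
  (forall d t, rel_of G d t -> d ∈ D /\ t ∈ T) /\
  (forall d t, d ∈ D -> t ∈ T -> clause (rel_of G) d t -> rel_of G d t) /\
  (forall R : M -> M -> Prop, D0 (fun v => R (v 0) (v 1)) ->
     (forall d t, d ∈ D -> t ∈ T -> clause R d t -> R d t) ->
     forall d t, rel_of G d t -> R d t).

(** The intersection of all closed subsets of [D × T]. For minimality, [R] is cut down to a set of
    pairs, which is closed by monotonicity. *)
Lemma generated_exists : exists G, generated G.
Proof.
pose proof D0_clause as Hcl.
assert (Hcl' : D0 (fun v : nat -> M =>
  (fun Y => clause (rel_of Y)) (v 0) (v 1) (v 2))) by exact Hcl.
destruct (relation_comprehension hM D T (R := fun _ _ => True)) as (F & HF & _).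
{ d0. }
destruct (powerset_exists hM F) as [P HP].
pose (closed Y := forall d, d ∈ D -> forall t, t ∈ T ->
  (fun Y => clause (rel_of Y)) Y d t -> rel_of Y d t).
assert (Hclosed : D0 (fun v : nat -> M => closed (v 0))).
{ apply (@D0_all _ (fun _ => D) (fun d v => forall t, t ∈ T ->
    clause (rel_of (v 0)) d t -> rel_of (v 0) d t)); [d0_term|].
  apply (@D0_all _ (fun _ => T) (fun t v =>
    clause (rel_of (v 1)) (v 0) t -> rel_of (v 1) (v 0) t)); [d0_term|].
  apply D0_imp; [|d0].
  apply (@D0_subst3 _ (fun Y => clause (rel_of Y)) (fun v => v 2) (fun v => v 1)
    (fun v => v 0)); auto; d0_term. }
destruct (relation_comprehension hM D T (R := fun d t => forall Y, Y ∈ P ->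
  closed Y -> rel_of Y d t)) as (G & HG & _); [d0|].
exists G; split; [|split].
- intros d t H; apply HG in H; tauto.
- intros d t Hd Ht H; apply HG; split; [|split]; auto.
  intros Y HY HcY; apply HcY; auto; revert H; apply clause_mono.
  intros e x _ _ Hex; apply HG in Hex; destruct Hex as (_ & _ & Hex); auto.
- intros R HR Hc.
  destruct (relation_comprehension hM D T HR) as (Y & HY & HpY).
  intros d t H; apply HG in H; destruct H as (_ & _ & H).
  apply (HY d t), H.
  + apply HP; intros p Hp; destruct (HpY p Hp) as (x & y & Hx & Hy & Hxy).
    assert (Hf : rel_of F x y) by (apply HF; auto).
    destruct Hf as (q & Hq & HqF); now rewrite (opair_unique hM Hxy Hq).
  + intros e He x Hx Hex; apply HY; split; [|split]; auto; apply Hc; auto.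
    revert Hex; apply clause_mono; intros e' x' _ _ H'; now apply HY in H'.
Qed.

(** As in the Knaster-Tarski theorem: the clause applied to [G] is closed by monotonicity, hence
    includes the least closed relation. *)
Lemma generated_inv G d t : generated G -> rel_of G d t -> clause (rel_of G) d t.
Proof.
intros (G1 & G2 & G3); apply (G3 (clause (rel_of G))).
- apply (@D0_subst3 _ (fun Y => clause (rel_of Y)) (fun _ => G) (fun v => v 0)
    (fun v => v 1)); try d0_term; apply D0_clause.
- intros d' t' _ _; apply clause_mono; auto.
Qed.

(** Induction on generation: the two kinds of names exclude each other, and equal argument names
    give equal arguments, hence the same least witness. *)
Lemma generated_fun G d t t' : generated G -> rel_of G d t -> rel_of G d t' -> t = t'.
Proof.
intros HG Ht; assert (HG' := HG); destruct HG' as (G1 & G2 & G3).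
assert (H : forall d t, rel_of G d t -> forall t', t' ∈ T -> rel_of G d t' -> t = t').
{ apply (G3 (fun d t => forall t', t' ∈ T -> rel_of G d t' -> t = t')); [d0|].
  intros c x _ Hx Hcx x' Hx' Hcx'; apply (generated_inv HG) in Hcx'.
  destruct Hcx as [[Ha Hb]|(Nb & u & Hu & Hc & Hl)],
    Hcx' as [[Ha' Hb']|(Nb' & u' & Hu' & Hc' & Hl')].
  - exact (base_fun Hb Hb').
  - destruct (Nb' x Ha Hb).
  - destruct (Nb x' Ha' Hb').
  - apply (least_unique (u := u')); auto; revert Hl; apply least_local.
    intros i Hi; destruct (Hc i Hi) as (e & He & Hie & He1).
    destruct (Hc' i Hi) as (e' & He' & Hie' & He1').
    rewrite <- (component_unique He He' Hie Hie') in He1'; apply He1; auto. }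
intros Ht'; apply (H d t Ht); auto; apply (G1 d t'); auto.
Qed.

Lemma generated_base G a : generated G -> a ∈ A -> exists d, rel_of G d a.
Proof.
intros (G1 & G2 & G3) Ha.
destruct (singleton_exists hM a) as [s Hs], (singleton_exists hM s) as [e He].
assert (HeD : e ∈ D).
{ apply HD; intros x Hx; apply He in Hx; subst x; apply HW; intros x Hx.
  apply Hs in Hx; now subst. }
destruct (tuple_exists (k := 1) (e := fun _ => e)) as (d & Hd & Hc); auto.
exists d; apply G2; auto; left; split; auto; exists e; repeat split; auto.
- apply (Hc 0); auto.
- apply (Hc 0); auto.
- exists s; split; [now apply He|now apply Hs].
- intros s' Hs' z Hz; apply He in Hs'; subst; now apply Hs.
Qed.

(** The least witness is named by the tuple of names of its arguments, preceded by the empty set: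
    that component codes nothing and so marks the tuple as a Skolem term. *)
Lemma generated_closed G (u : nat -> M) x : generated G ->
  (forall i, exists d, rel_of G d (u i)) -> x ∈ T -> Q (scons x u) ->
  exists x', (exists d, rel_of G d x') /\ Q (scons x' u).
Proof.
intros (G1 & G2 & G3) Hu Hx HQx.
pose (e i := proj1_sig (constructive_indefinite_description _ (Hu i))).
assert (He : forall i, rel_of G (e i) (u i))
  by (intros i; exact (proj2_sig (constructive_indefinite_description _ (Hu i)))).
assert (HeD : forall i, e i ∈ D) by (intros i; eapply G1; eauto).
assert (HzD : zero ∈ D) by (apply HD; intros z Hz; destruct (Hzero Hz)).
destruct (tuple_exists (k := S k) (e := scons zero e)) as (d & Hd & Hc).
{ intros [|i] _; simpl; auto. }
destruct (least_exists Hx HQx) as (y & Hy & Hl).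
exists y; split; [|apply Hl]; exists d; apply G2; auto; right; split.
- intros a _ (e' & He' & Hc' & (s & Hs & _) & _).
  assert (E : e' = zero).
  { apply (component_unique He' HzD Hc'); apply (Hc 0); lia. }
  subst e'; destruct (Hzero Hs).
- exists u; split; [intros i _; now apply (G1 (e i))|split; auto].
  intros i Hi; exists (e i); repeat split; auto; apply (Hc (S i)); lia || auto.
Qed.

End Codes.

(** * Reflection of Σ1 formulas *)

Section Reflection.
Variable M : structure.
Implicit Types (x y z : M) (u v : nat -> M) (N : M -> Prop).

(** The Tarski-Vaught condition for [Q] between [N] and [T]. *)
Definition witnesses N T (Q : (nat -> M) -> Prop) : Prop :=
  forall u, (forall i, N (u i)) -> forall x, x ∈ T -> Q (scons x u) ->
    exists x', N x' /\ Q (scons x' u).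

(* One more variable selects the predicate to be witnessed, according to
   whether its value is [c]. *)
Lemma witnesses_combine (c : M) (l : list ((nat -> M) -> Prop)) :
  (forall Q, In Q l -> D0 Q /\ exists k, local k Q) ->
  exists Q k, D0 Q /\ local k Q /\
    forall N T, N c -> (exists a, N a /\ a <> c) -> witnesses N T Q ->
      forall Q', In Q' l -> witnesses N T Q'.
Proof.
induction l as [|Q1 l IH]; intros H.
- exists (fun _ => False), 0; repeat split; [d0|now intros u v _ |].
  intros N T _ _ _ Q' [].
- destruct IH as (Q2 & k2 & H2 & L2 & W2); [intros Q HQ; apply H; now right|].
  destruct (H Q1) as (H1 & k1 & L1); [now left|].
  pose (k := max k1 k2).
  (* The selector lies beyond the variables of [Q1] and [Q2]; its index is [k] once the witness at
     index 0 is removed. *)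
  exists (fun u => u (S k) = c /\ Q1 u \/ u (S k) <> c /\ Q2 u), (S (S k)).
  split; [|split].
  + apply D0_or; apply D0_and; auto; d0.
  + intros u v E; rewrite <- (E (S k)) by lia.
    intros [[Hk HQ]|[Hk HQ]]; [left|right]; split; auto;
      [apply (L1 u)|apply (L2 u)]; auto; intros; apply E; lia.
  + intros N T Nc (a & Na & Nac) HW.
    pose (change b (u : nat -> M) i := if i =? k then b else u i).
    assert (Ek : forall b x u, scons x (change b u) (S k) = b).
    { intros; unfold change; simpl; now rewrite Nat.eqb_refl. }
    assert (E : forall b x u i, i < k -> scons x u i = scons x (change b u) i).
    { intros b x u [|i] Hi; auto; unfold change; simpl.
      destruct (Nat.eqb_spec i k); auto; lia. }
    assert (Nch : forall b u, N b -> (forall i, N (u i)) -> forall i, N (change b u i)).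
    { intros b u Hb Hu i; unfold change; destruct (Nat.eqb i k); auto. }
    intros Q' [<-|HQ'].
    * intros u Hu x Hx HQ.
      destruct (HW (change c u)) with (x := x) as (x' & Nx' & [[_ Hx']|[Ne _]]); auto.
      -- left; split; auto; apply (L1 (scons x u)); auto; intros; apply E; lia.
      -- exists x'; split; auto; apply (L1 (scons x' (change c u))); auto.
         intros; symmetry; apply E; lia.
      -- destruct Ne; auto.
    * apply (W2 N T); auto; [exists a; auto|].
      intros u Hu x Hx HQ.
      destruct (HW (change a u)) with (x := x) as (x' & Nx' & [[Ne _]|[_ Hx']]); auto.
      -- right; rewrite Ek; split; auto.
         apply (L2 (scons x u)); auto; intros; apply E; lia.
      -- rewrite Ek in Ne; contradiction.
      -- exists x'; split; auto; apply (L2 (scons x' (change a u))); auto.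
         intros; symmetry; apply E; lia.
Qed.

(** On [N] the map [f] is an isomorphism. An element [y] of [N] may have elements outside [N],
    whereas [f y] has only images from [N]; the Tarski-Vaught condition bridges this at each
    quantifier. *)
Lemma Delta0_collapse N T (f : M -> M) :
  (forall x y, N x -> N y -> (x ∈ y <-> f x ∈ f y)) ->
  (forall x y, N x -> N y -> f x = f y -> x = y) ->
  (forall y z, N y -> z ∈ f y -> exists x, N x /\ x ∈ y /\ z = f x) ->
  (forall x y, N y -> x ∈ y -> x ∈ T) ->
  forall p, Delta0 p ->
    (forall q, In q (skolem_forms p) -> witnesses N T (fun u => sat u q)) ->
    forall u, (forall i, N (u i)) -> (sat u p <-> sat (fun i => f (u i)) p).
Proof.
intros Fmem Finj Fsurj NT.
assert (Es : forall x u, (fun i => f (scons x u i)) = scons (f x) (fun i => f (u i))).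
{ intros x u; extensionality i; now destruct i. }
assert (Ns : forall x u, N x -> (forall i, N (u i)) -> forall i, N (scons x u i)).
{ intros x u Hx Hu [|i]; simpl; auto. }
induction 1 as [i k|i k| |p q Hp IHp Hq IHq|p q Hp IHp Hq IHq|p q Hp IHp Hq IHq
  |i p Hp IHp|i p Hp IHp]; intros W u Hu; simpl in W |- *.
- now apply Fmem.
- split; [now intros ->|apply Finj; auto].
- tauto.
- rewrite <- IHp, <- IHq; auto; [tauto|..]; intros; apply W, in_app_iff; auto.
- rewrite <- IHp, <- IHq; auto; [tauto|..]; intros; apply W, in_app_iff; auto.
- rewrite <- IHp, <- IHq; auto; [tauto|..]; intros; apply W, in_app_iff; auto.
- specialize (IHp (fun q Hq => W q (or_intror Hq))); split.
  + intros H z Hz; destruct (Fsurj (u i) z) as (x & Nx & Hx & ->); auto.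
    rewrite <- Es; apply (IHp (scons x u)); auto.
  + intros H x Hx; apply NNPP; intros Hn.
    destruct (W _ (or_introl eq_refl) u Hu x) as (x' & Nx' & Hx').
    * exact (NT x (u i) (Hu i) Hx).
    * simpl; auto.
    * simpl in Hx'; apply Hx'; intros Hxi; apply (IHp (scons x' u)); auto.
      rewrite Es; apply H; now apply (Fmem x' (u i)).
- specialize (IHp (fun q Hq => W q (or_intror Hq))); split.
  + intros (x & Hx & Hs).
    destruct (W _ (or_introl eq_refl) u Hu x) as (x' & Nx' & Hx' & Hs').
    * exact (NT x (u i) (Hu i) Hx).
    * simpl; auto.
    * exists (f x'); split; [now apply (Fmem x' (u i))|].
      rewrite <- Es; apply (IHp (scons x' u)); auto.
  + intros (z & Hz & Hs); destruct (Fsurj (u i) z) as (x & Nx & Hx & ->); auto.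
    exists x; split; auto; apply (IHp (scons x u)); auto; now rewrite Es.
Qed.

End Reflection.

(** * Reflection into the hereditarily fixed elements *)

Section FixedReflection.
Variables (M : structure) (hM : models_MOST M) (j : M -> M) (hj : automorphism j)
  (omega : M) (Homega : inductive_set omega) (hfix : I_fix j omega).
Implicit Types (a b c d x y z : M) (u v : nat -> M).

(* Downward Löwenheim-Skolem: the Skolem hull [N] in [T] of a transitive set
   [A] of fixed elements is coded by a fixed set [D], and so its collapse is
   hereditarily fixed. *)
Lemma Delta0_reflection p n v : Delta0 p -> (forall i, n <= i -> I_fix j (v i)) ->
  sat v p -> exists v', (forall i, I_fix j (v' i)) /\
    (forall i, n <= i -> v' i = v i) /\ sat v' p.
Proof.
intros Hp Hv Hs.
pose (k := var_bound p).
destruct (I_fix_transitive_witness hM hj hfix) as (A0 & IA0 & TA0 & HA0).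
(* [A] encloses ω and the parameters [v i] with [n <= i < k]; the values below [n] are the witnesses
   to be replaced. *)
destruct (transitive_sup hM (J := I_fix j) (S := fun i => n <= i) (v := v) (a := A0) k)
  as (A & IA & TA & HA0A & HvA); auto.
{ intros x y z; now apply I_fix_cup. }
{ intros i Hi; apply (I_fix_transitive_witness hM hj); auto. }
assert (HoA : incl omega A) by (intros x Hx; apply HA0A, (TA0 omega); auto).
destruct (transitive_sup hM (J := fun _ => True) (S := fun _ => True) (v := v) (a := A) k)
  as (T & _ & TT & HAT & HvT); auto.
{ intros i _; destruct (singleton_exists hM (v i)) as [s Hsi].
  destruct (Mac_transitive_containment (MOST_Mac hM) s) as (t & Tt & Hst).
  exists t; repeat split; auto; apply Hst, Hsi; auto. }
destruct (powerset_exists hM A) as [W HW], (powerset_exists hM W) as [D HD].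
assert (ID : I_fix j D).
{ apply (I_fix_powerset hM hj HD), (I_fix_powerset hM hj HW IA). }
destruct (Mac_choice (MOST_Mac hM) T) as (r & _ & Hr).
destruct (proj1 Homega) as (zero & Hzero & Hzo).
(* Variable 0 lies in the symmetric difference of variables 1 and 2. Reflecting this makes [N]
   extensional, hence its collapse injective. *)
pose (ext := fOr (fAnd (fMem 0 1) (fImp (fMem 0 2) fBot))
  (fAnd (fMem 0 2) (fImp (fMem 0 1) fBot))).
(* The predicates [u 0 = v i] force the values of [v] into the hull. *)
pose (l := map (fun q u => sat u q) (ext :: skolem_forms p) ++
  map (fun i u => u 0 = v i) (seq 0 k)).
destruct (@witnesses_combine M zero l) as (Q & m & HQ & LQ & WQ).
{ intros Q HQ; apply in_app_iff in HQ; destruct HQ as [HQ|HQ];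
    apply in_map_iff in HQ; destruct HQ as (q & <- & Hq).
  - split; [apply D0_sat|exists (var_bound q); apply sat_local].
    destruct Hq as [<-|Hq]; [repeat constructor|apply (Delta0_skolem_forms Hp Hq)].
  - split; [d0|exists 1; intros u w E; rewrite (E 0); auto]. }
destruct (generated_exists hM omega zero A W D T r HQ LQ)
  as [G HG].
assert (Gfun := fun d t t' => @generated_fun M hM omega zero A W D HD T r Q m Hr HQ LQ
  G d t t' HG).
assert (GD := proj1 HG).
destruct (comprehension hM T (P := fun t => exists d, d ∈ D /\ rel_of G d t))
  as [N HN]; [d0|].
assert (NG : forall t, t ∈ N <-> exists d, rel_of G d t).
{ intros t; rewrite HN; split.
  - intros (_ & d & _ & Hd); eauto.
  - intros (d & Hd); destruct (GD d t Hd); eauto. }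
assert (HAN : incl A N).
{ intros a Ha; apply NG.
  apply (generated_base hM Homega Hzero HoA HW HD HAT HG Ha). }
assert (WN : forall Q', In Q' l -> witnesses (fun x => x ∈ N) T Q').
{ apply WQ; auto.
  - destruct (proj2 Homega zero Hzo) as (s & Hs1 & Hso); exists s; split; auto.
    intros E; subst; apply (Hzero zero), Hs1; auto.
  - intros u Hu x Hx HQx.
    destruct (generated_closed hM Homega Hzero HoA HW HD Hr HQ HG (u := u) (x := x))
      as (x' & Hx' & HQx'); auto.
    + intros i; now apply NG.
    + exists x'; split; auto; now apply NG. }
destruct (collapse_exists hM N TT) as (h & Ch & Dh).
destruct (range_exists hM h) as [b Hb].
destruct (choice (fun x y => x ∈ T -> rel_of h x y)) as [f Hf].
{ intros x; destruct (classic (x ∈ T)) as [Hx|Hx].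
  - destruct (Dh x Hx) as [y Hy]; eauto.
  - exists x; contradiction. }
assert (hf : forall x y, x ∈ T -> rel_of h x y -> y = f x).
{ intros x y Hx Hxy; apply (collapses_unique hM Ch Ch Hxy); auto. }
assert (NT : forall x, x ∈ N -> x ∈ T) by (intros x Hx; now apply HN).
assert (Fmem : forall x y, x ∈ N -> y ∈ T -> x ∈ y -> f x ∈ f y).
{ intros x y Hx Hy Hxy; destruct (Ch y (f y) (Hf y Hy)) as [C1 _].
  destruct (C1 x) as (z & Hz & Hxz); auto.
  rewrite <- (hf x z); auto. }
assert (Fsurj : forall y z, y ∈ T -> z ∈ f y ->
  exists x, x ∈ N /\ x ∈ y /\ z = f x).
{ intros y z Hy Hz; destruct (Ch y (f y) (Hf y Hy)) as [_ C2].
  destruct (C2 z Hz) as (x & [Hxy Hx] & Hxz); exists x; auto. }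
assert (Finj : forall x x', x ∈ N -> x' ∈ N -> f x = f x' -> x = x').
(* Phrased through [h], an element of [M], because [f] comes from choice outside [M] and induction
   asks for a Δ0 predicate. *)
{ assert (H : forall x, x ∈ N -> forall x', x' ∈ N -> forall y, y ∈ b ->
    rel_of h x y -> rel_of h x' y -> x = x').
  2: { intros x x' Hx Hx' E; apply (H x Hx x' Hx' (f x)); eauto; rewrite E; auto. }
  refine (@set_induction M hM _ _ _ _); [d0|].
  intros x Hx IH x' Hx' y _ Hxy Hxy'; apply NNPP; intros Ne.
  assert (E : f x = f x') by (rewrite <- (hf x y), <- (hf x' y); auto).
  assert (IH' : forall c c', c ∈ x -> c ∈ N -> c' ∈ N -> f c = f c' -> c = c').
  { intros c c' Hc HcN Hc' Ec; apply (IH c Hc HcN c' Hc' (f c)); eauto.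
    rewrite Ec; auto. }
  assert (Hz : exists z, z ∈ T /\ (z ∈ x /\ ~ z ∈ x' \/ z ∈ x' /\ ~ z ∈ x)).
  { apply NNPP; intros Hz; apply Ne, (set_ext hM); intros z.
    split; intros Hzx; apply NNPP; intros Hzx'; apply Hz; exists z;
      split; auto; [apply (TT x)|apply (TT x')]; auto. }
  destruct Hz as (z & HzT & Hz).
  destruct (WN (fun u => sat u ext)) with (u := scons x (fun _ => x')) (x := z)
    as (c & Hc & Hcx); auto.
  - now left.
  - intros [|i]; auto.
  - destruct Hcx as [[H1 H2]|[H1 H2]]; simpl in H1, H2; apply H2.
    + assert (Hfc : f c ∈ f x') by (rewrite <- E; auto).
      destruct (Fsurj x' (f c)) as (c' & Hc' & Hcx' & Ec); auto.
      rewrite (IH' c c'); auto.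
    + assert (Hfc : f c ∈ f x) by (rewrite E; auto).
      destruct (Fsurj x (f c)) as (c' & Hc' & Hcx' & Ec); auto.
      rewrite <- (IH' c' c); auto. }
assert (FA : forall a, a ∈ A -> f a = a).
{ assert (H : forall a, a ∈ A -> rel_of h a a).
  2: { intros a Ha; symmetry; auto. }
  refine (@set_induction M hM _ _ _ _); [d0|].
  intros a Ha IH; assert (E : f a = a); [|rewrite <- E at 2; auto].
  apply (set_ext hM); intros z; split; intros Hz.
  - destruct (Fsurj a z) as (x & Hx & Hxa & ->); auto.
    rewrite <- (hf x x); auto; apply IH; auto; now apply (TA a).
  - assert (HzA : z ∈ A) by now apply (TA a).
    rewrite (hf z z); auto. }
(* [E] is membership pulled back to names along [G], and [g] is [G] followed by [h]; so [g]
   collapses a relation on the fixed set [D]. *)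
assert (FI : forall x, x ∈ N -> I_fix j (f x)).
{ destruct (relation_comprehension hM D D (R := fun c d => exists s, s ∈ T /\
    exists t, t ∈ T /\ ((rel_of G c s /\ rel_of G d t) /\ s ∈ t))) as (E & HE & HpE);
    [d0|].
  destruct (relation_comprehension hM D b (R := fun d y => exists t, t ∈ T /\
    (rel_of G d t /\ rel_of h t y))) as (g & Hg & _); [d0|].
  assert (Cg : collapses (rel_of E) g).
  { intros d y Hdy; apply Hg in Hdy; destruct Hdy as (Hd & _ & t & Ht & Hdt & Hty).
    destruct (Ch t y Hty) as [C1 C2]; split.
    - intros c Hc; apply HE in Hc.
      destruct Hc as (HcD & _ & s & HsT & t' & _ & (Hcs & Hdt') & Hst).
      rewrite <- (Gfun d t t') in Hst by auto.
      destruct (C1 s) as (y' & Hy' & Hsy'); [split; [auto|apply NG; eauto]|].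
      exists y'; split; auto; apply Hg; repeat split; eauto 10.
    - intros y' Hy'; destruct (C2 y' Hy') as (s & [Hst HsN] & Hsy').
      apply NG in HsN as HsG; destruct HsG as [c Hc]; destruct (GD c s Hc).
      exists c; split; [apply HE|apply Hg]; repeat split; eauto 10. }
  intros x Hx; apply NG in Hx as HxG; destruct HxG as [d Hd]; destruct (GD d x Hd).
  apply (I_fix_collapse hM hj ID HpE Cg) with (x := d).
  - intros c y Hcy; now apply Hg in Hcy.
  - apply Hg; repeat split; eauto 10. }
assert (HvN : forall i, i < k -> v i ∈ N).
{ intros i Hi; destruct (WN (fun u => u 0 = v i)) with (u := fun _ : nat => zero)
    (x := v i) as (x & Hx & Ex); auto.
  - apply in_app_iff; right; apply in_map_iff; exists i; split; auto.
    apply in_seq; lia.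
  - simpl in Ex; now subst. }
(* Values from [k] on do not affect [p]; [zero] keeps the assignment inside [N]. *)
pose (w i := if i <? k then v i else zero).
assert (Hw : forall i, w i ∈ N).
{ intros i; unfold w; destruct (Nat.ltb_spec i k); auto. }
assert (Sw : sat (fun i => f (w i)) p).
{ refine (proj1 (@Delta0_collapse M (fun x => x ∈ N) T f _ _ _ _ p Hp _ w Hw) _); auto.
  - intros x y Hx Hy; split; auto; intros Hxy.
    destruct (Fsurj y (f x)) as (x' & Hx' & Hx'y & E); auto.
    rewrite (Finj x x'); auto.
  - intros x y Hy Hxy; apply (TT y); auto.
  - intros q Hq; apply WN, in_app_iff; left; right; apply in_map_iff; eauto.
  - revert Hs; apply sat_local; intros i Hi; unfold w.
    destruct (Nat.ltb_spec i k); auto; unfold k in *; lia. }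
(* Parameters below [k] lie in [A] and so are unmoved by [f]; [omega] is a fixed default for the
   remaining indices. *)
exists (fun i => if i <? k then f (v i) else if n <=? i then v i else omega).
repeat split.
- intros i; destruct (Nat.ltb_spec i k); auto; destruct (Nat.leb_spec n i); auto.
- intros i Hi; destruct (Nat.ltb_spec i k); auto.
  destruct (Nat.leb_spec n i); auto; lia.
- revert Sw; apply sat_local; intros i Hi; unfold w.
  destruct (Nat.ltb_spec i k); auto; unfold k in *; lia.
Qed.

(** Stripping an existential quantifier adds one replaceable variable, which raises [n] by one. *)
Lemma Sigma1_reflection p : Sigma1 p -> forall n v,
  (forall i, n <= i -> I_fix j (v i)) -> sat v p ->
  exists v', (forall i, I_fix j (v' i)) /\ (forall i, n <= i -> v' i = v i) /\ sat v' p.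
Proof.
induction 1 as [p Hp|p _ IH]; intros n v Hv Hs; [now apply Delta0_reflection|].
destruct Hs as [x Hs]; destruct (IH (S n) (scons x v)) as (w & Iw & Ew & Sw); auto.
{ intros [|i] Hi; [lia|apply Hv; lia]. }
exists (fun i => w (S i)); repeat split; auto.
- intros i Hi; apply (Ew (S i)); lia.
- exists (w 0); replace (scons (w 0) (fun i => w (S i))) with w; auto.
  extensionality i; now destruct i.
Qed.

End FixedReflection.

(** * Initial substructures *)

Section EndExtensions.
Variables (M : structure) (I : M -> Prop) (HI : end_extension I).

Local Notation sub := (substructure I).
Local Notation val := (@proj1_sig M I).

Lemma sub_eq (x y : sub) : val x = val y -> x = y.
Proof.
destruct x as [x hx], y as [y hy]; simpl; intros ->; f_equal; apply proof_irrelevance.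
Qed.

Lemma sub_lift (x : M) (y : sub) : x ∈ val y -> exists z : sub, val z = x.
Proof. intros H; now exists (exist I x (HI (proj2_sig y) H)). Qed.

Lemma sub_incl (x y : sub) : incl x y <-> incl (val x) (val y).
Proof.
split; intros H z Hz; [|apply H, Hz].
destruct (sub_lift Hz) as [w <-]; apply H, Hz.
Qed.

Lemma sub_upair (p a b : sub) : is_upair p a b <-> is_upair (val p) (val a) (val b).
Proof.
split; intros H z; split.
- intros Hz; destruct (sub_lift Hz) as [w <-]; apply H in Hz.
  destruct Hz; subst; auto.
- intros [->| ->]; [apply (H a)|apply (H b)]; auto.
- intros Hz; apply H in Hz; destruct Hz as [Hz|Hz]; apply sub_eq in Hz; auto.
- intros [->| ->]; apply H; auto.
Qed.

Lemma sub_singleton (s a : sub) : is_singleton s a <-> is_singleton (val s) (val a).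
Proof.
assert (E : forall (N : structure) (t c : N), is_singleton t c <-> is_upair t c c).
{ intros N t c; split; intros H z; rewrite (H z); tauto. }
now rewrite !E, sub_upair.
Qed.

Lemma sub_opair (p a b : sub) : is_opair p a b <-> is_opair (val p) (val a) (val b).
Proof.
split.
- intros (s & t & Hs & Ht & Hp); exists (val s), (val t).
  now rewrite <- sub_singleton, <- !sub_upair.
- intros (s & t & Hs & Ht & Hp).
  assert (Hsp : s ∈ val p) by (apply Hp; auto).
  assert (Htp : t ∈ val p) by (apply Hp; auto).
  destruct (sub_lift Hsp) as [s' <-], (sub_lift Htp) as [t' <-]; exists s', t'.
  now rewrite sub_singleton, !sub_upair.
Qed.

Lemma sub_rel_of (r a b : sub) : rel_of r a b <-> rel_of (val r) (val a) (val b).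
Proof.
split.
- intros (p & Hp & Hr); exists (val p); split; auto; now rewrite <- sub_opair.
- intros (p & Hp & Hr); destruct (sub_lift Hr) as [p' <-].
  exists p'; split; auto; now rewrite sub_opair.
Qed.

Lemma sub_scons (x : sub) (v : nat -> sub) :
  (fun i => val (scons x v i)) = scons (val x) (fun i => val (v i)).
Proof. extensionality i; now destruct i. Qed.

Lemma sub_Delta0 p : Delta0 p -> forall v : nat -> sub,
  sat v p <-> sat (fun i => val (v i)) p.
Proof.
induction 1 as [i k|i k| |p q Hp IHp Hq IHq|p q Hp IHp Hq IHq|p q Hp IHp Hq IHq
  |i p Hp IHp|i p Hp IHp]; intros v; simpl.
- reflexivity.
- split; [now intros ->|apply sub_eq].
- tauto.
- rewrite IHp, IHq; tauto.
- rewrite IHp, IHq; tauto.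
- rewrite IHp, IHq; tauto.
- split; intros H x Hx.
  + destruct (sub_lift Hx) as [y <-]; rewrite <- sub_scons; apply (IHp (scons y v)).
    apply H, Hx.
  + apply IHp; rewrite sub_scons; apply H, Hx.
- split; intros (x & Hx & H).
  + exists (val x); split; auto; rewrite <- sub_scons; now apply (IHp (scons x v)).
  + destruct (sub_lift Hx) as [y <-]; exists y; split; auto.
    apply IHp; now rewrite sub_scons.
Qed.

End EndExtensions.

(** * The axioms of MOST for the hereditarily fixed elements *)

Section HCut.
Variables (M : structure) (hM : models_MOST M) (j : M -> M) (hj : automorphism j)
  (omega : M) (Homega : inductive_set omega) (hfix : I_fix j omega).

Local Notation I := (I_fix j).
Local Notation sub := (substructure I).
Local Notation val := (@proj1_sig M I).

Lemma I_fix_end_extension : end_extension I.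
Proof. intros x y; apply (I_fix_mem hM). Qed.

Local Notation HI := I_fix_end_extension.

(** Upward this is Δ0-absoluteness. Downward, reflection with [n := 1] replaces the witness,
    variable 0, and keeps the parameters. *)
Lemma sub_Sigma1 p : Sigma1 p -> forall v : nat -> sub,
  sat v p <-> sat (fun i => val (v i)) p.
Proof.
induction 1 as [p Hp|p Hp IH]; intros v; [now apply (sub_Delta0 HI)|simpl; split].
- intros [x Hx]; exists (val x); rewrite <- sub_scons; now apply (IH (scons x v)).
- intros [x Hx].
  destruct (Sigma1_reflection hM hj Homega hfix Hp (n := 1)
    (v := scons x (fun i => val (v i)))) as (w & Iw & Ew & Sw); auto.
  + intros [|i] Hi; [lia|apply (proj2_sig (v i))].
  + exists (exist I (w 0) (Iw 0)); apply IH; rewrite sub_scons.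
    replace (scons _ _) with w; auto.
    extensionality i; destruct i as [|i]; auto; apply Ew; lia.
Qed.

(** The set separated in [M] is a subset of a hereditarily fixed set. *)
Lemma sub_separation : separation sub Sigma1.
Proof.
intros p Hp v a.
destruct (MOST_Sigma1_separation hM Hp (fun i => val (v i)) (val a)) as [b Hb].
assert (Ib : I b).
{ apply (I_fix_subset hM hj (proj2_sig a)); intros x Hx; now apply Hb. }
exists (exist I b Ib); intros x.
rewrite (sub_Sigma1 Hp), sub_scons; apply (Hb (val x)).
Qed.

(* A collecting set exists in [M], and to be one is a Δ0 property. *)
Lemma sub_collection : collection sub Delta0.
Proof.
intros p Hp v a H.
destruct (MOST_Delta0_collection hM Hp (v := fun i => val (v i)) (a := val a))
  as [b Hb].
{ intros x Hx; destruct (sub_lift HI Hx) as [x' <-].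
  destruct (H x' Hx) as [y Hy]; exists (val y).
  now rewrite <- !sub_scons; apply (sub_Delta0 HI). }
(* Below the two quantifiers of [q] the variables are [y], [x], [b], [a] and the parameters; [f]
   skips [b] and [a], which [p] does not mention. *)
pose (f i := match i with 0 => 0 | 1 => 1 | S (S i) => S (S (S (S i))) end).
pose (q := fAll (fImp (fMem 0 2) (fEx (fAnd (fMem 0 2) (ren f p))))).
assert (Ef : forall (y x b a : M) v,
  (fun i => scons y (scons x (scons b (scons a v))) (f i)) = scons y (scons x v)).
{ intros; extensionality i; now destruct i as [|[|i]]. }
destruct (Delta0_reflection hM hj Homega hfix (p := q) (n := 1)
  (v := scons b (scons (val a) (fun i => val (v i))))) as (w & Iw & Ew & Sw).
- repeat constructor; now apply Delta0_ren.
- intros [|[|i]] Hi; simpl; [lia|apply (proj2_sig a)|apply (proj2_sig (v i))].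
- intros x Hx; destruct (Hb x Hx) as (y & Hy & Hs); exists y; split; auto.
  now rewrite sat_ren, Ef.
- exists (exist I (w 0) (Iw 0)); intros x Hx.
  assert (E : w = scons (w 0) (scons (val a) (fun i => val (v i)))).
  { extensionality i; destruct i as [|i]; auto; apply Ew; lia. }
  rewrite E in Sw; destruct (Sw (val x) Hx) as (y & Hy & Hs).
  rewrite sat_ren, Ef in Hs; simpl in Hy.
  exists (exist I y (HI (Iw 0) Hy)); split; auto.
  apply (sub_Delta0 HI Hp); now rewrite !sub_scons.
Qed.

(** Well-ordering passes down because every subset in the substructure is already a subset in
    [M]. *)
Lemma sub_well_orders (R : M -> M -> Prop) (R' : sub -> sub -> Prop) (x : sub) :
  (forall a b, R' a b <-> R (val a) (val b)) ->
  well_orders R (val x) -> well_orders R' x.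
Proof.
intros E (H1 & H2 & H3 & H4); repeat split.
- intros a Ha; rewrite E; now apply H1.
- intros a b c Ha Hb Hc; rewrite !E; now apply H2.
- intros a b Ha Hb; rewrite !E.
  destruct (H3 (val a) (val b) Ha Hb) as [H|[H|H]]; auto.
  apply sub_eq in H; auto.
- intros s Hs [a Ha]; apply (sub_incl HI) in Hs.
  destruct (H4 (val s) Hs) as (b & Hb & Hmin); [now exists (val a)|].
  destruct (sub_lift HI Hb) as [b' <-]; exists b'; split; auto.
  intros c Hc; rewrite E; destruct (Hmin (val c) Hc) as [H|H]; auto.
  apply sub_eq in H; auto.
Qed.

Lemma sub_Mac : models_Mac sub.
Proof.
assert (Lift : forall x, I x -> exists x' : sub, val x' = x).
{ intros x Hx; now exists (exist I x Hx). }
constructor.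
- intros x y H; apply sub_eq, (set_ext hM); intros z; split; intros Hz;
    destruct (sub_lift HI Hz) as [w <-]; apply H, Hz.
- intros a b; destruct (upair_exists hM (val a) (val b)) as [p Hp].
  destruct (Lift p) as [p' <-].
  + apply (I_fix_upair hM hj Hp); apply proj2_sig.
  + exists p'; now rewrite sub_upair by exact HI.
- destruct (proj1 Homega) as (e & He & Heo).
  exists (exist I e (HI hfix Heo)); intros z; apply He.
- intros x; destruct (union_exists hM (val x)) as [u Hu].
  destruct (Lift u) as [u' <-].
  + apply (I_fix_of_elements hM hj); intros z Hz; apply Hu in Hz.
    destruct Hz as (y & Hy & Hz); exact (HI (HI (proj2_sig x) Hy) Hz).
  + exists u'; intros z; split.
    * intros Hz; apply (Hu (val z)) in Hz; destruct Hz as (y & Hy & Hz).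
      destruct (sub_lift HI Hy) as [y' <-]; now exists y'.
    * intros (y & Hy & Hz); apply (Hu (val z)); now exists (val y).
- destruct Homega as [(e & He & Heo) Hs]; exists (exist I omega hfix); split.
  + exists (exist I e (HI hfix Heo)); split; auto; intros z; apply He.
  + intros y Hy; destruct (Hs (val y) Hy) as (s & Hsy & Hso).
    exists (exist I s (HI hfix Hso)); split; auto; intros z; split.
    * intros Hz; apply (Hsy (val z)) in Hz; destruct Hz as [Hz|Hz]; auto.
      right; now apply sub_eq.
    * intros [Hz| ->]; apply (Hsy _); auto.
- intros x; destruct (powerset_exists hM (val x)) as [y Hy].
  exists (exist I y (I_fix_powerset hM hj Hy (proj2_sig x))); intros z.
  rewrite (sub_incl HI); apply (Hy (val z)).
- intros x; destruct (I_fix_transitive_witness hM hj (proj2_sig x)) as (u & Iu & Tu & Hu).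
  exists (exist I u Iu); split.
  + intros y z; apply (Tu (val y)).
  + intros z Hz; exact (Tu _ _ Hu Hz).
- intros p Hp; apply sub_separation; now constructor.
- intros x [y Hy]; destruct (Mac_foundation (MOST_Mac hM) (x := val x))
    as (z & Hz & Hmin); [now exists (val y)|].
  destruct (sub_lift HI Hz) as [z' <-]; exists z'; split; auto.
  intros (w & Hw & Hwx); apply Hmin; now exists (val w).
- intros x; destruct (Mac_choice (MOST_Mac hM) (val x)) as (r & Hr & Hwo).
  destruct (Lift r) as [r' <-].
  + apply (I_fix_of_elements hM hj); intros p Hp.
    destruct (Hr p Hp) as (a & b & Ha & Hb & Hab).
    exact (I_fix_opair hM hj Hab (HI (proj2_sig x) Ha) (HI (proj2_sig x) Hb)).
  + exists r'; split.
    * intros p Hp; destruct (Hr (val p) Hp) as (a & b & Ha & Hb & Hab).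
      destruct (sub_lift HI Ha) as [a' <-], (sub_lift HI Hb) as [b' <-].
      exists a', b'; split; [|split]; auto; now rewrite sub_opair by exact HI.
    * revert Hwo; apply sub_well_orders; intros a b; apply (sub_rel_of HI).
Qed.

End HCut.

Theorem theorem3p4 (M : structure) (hM : models_MOST M)
    (j : M -> M) (hj : automorphism j) (hnt : ~ (forall x : M, j x = x))
    (omega : M) (homega : is_omega omega) (hfix : I_fix j omega) :
  H_cut (I_fix j).
Proof.
assert (HI := I_fix_end_extension hM (j := j)).
split; [split; [split; [|split]|split]|split]; auto.
- apply not_all_ex_not in hnt; destruct hnt as [x Hx]; exists x.
  intros Ix; apply Hx, (I_fix_fixed hM Ix).
(* The ordinals of the substructure are hereditarily fixed, hence so is any set of them. *)
- intros C HC; apply (I_fix_of_elements hM hj); intros x Hx.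
  now destruct (HC x Hx).
- intros x y Hy; now apply I_fix_subset.
- exact (sub_Mac hM hj (proj1 homega) hfix).
- exact (sub_separation hM hj (proj1 homega) hfix).
- exact (sub_collection hM hj (proj1 homega) hfix).
Qed.
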